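(* Let $P$ be a finite set of points in the Euclidean plane with $|P|$ even, and let $M$ be a $3$-local maximum perfect matching on $P$. Let $M^*$ be a maximum-length perfect matching on $P$. Then $w(M)\geqslant \frac{\sqrt{3}}{2}\, w(M^* )$.
   Context: A perfect matching on a finite point set $P$ in the plane is a partition of $P$ into pairs; each pair $\{a,b\}$ is regarded as the straight-line segment (edge) $ab$. For a set $E$ of segments, $w(E)$ denotes the sum of the Euclidean lengths of its segments. A perfect matching $M$ on $P$ is a maximum-length (globally maximum) matching if $w(M)\geqslant w(M')$ for every perfect matching $M'$ on $P$. For an integer $k$, a perfect matching $M$ is $k$-local maximum if for every subset $M'=\{a_1b_1,\dots,a_kb_k\}$ of $k$ edges of $M$, $M'$ is a maximum-length perfect matching on the point set $\{a_1,b_1,\dots,a_k,b_k\}$.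
   Formalization: ''3-local maximum'' is taken to require that every subset of at most 3 edges (not exactly 3) is maximum-length; with at least 3 edges this is equivalent, and with 2 edges the literal condition is vacuous and the claim fails (a square matched by opposite sides). *)

(* Defs.v *)
From HB Require Import structures.
From mathcomp Require Import all_boot all_order all_algebra.
From mathcomp Require Import reals.
Set Implicit Arguments. Unset Strict Implicit. Unset Printing Implicit Defensive.
Import Order.TTheory GRing.Theory Num.Theory.
Local Open Scope ring_scope.

Definition dist (R : realType) (a b : R * R) : R :=
  Num.sqrt ((a.1 - b.1) ^+ 2 + (a.2 - b.2) ^+ 2).

(* The point set P is given as an injective family p : 'I_n -> R * R.
   An edge is a pair (i, j) of indices; a matching is a set of edges. *)

Definition perfect_matching (n : nat) (S : {set 'I_n}) (M : {set 'I_n * 'I_n}) : Prop :=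
  (forall e, e \in M -> [/\ e.1 != e.2, e.1 \in S & e.2 \in S]) /\
  (forall v, v \in S -> #|[set e in M | (e.1 == v) || (e.2 == v)]| = 1%N).

Definition weight (R : realType) (n : nat) (p : 'I_n -> R * R)
  (M : {set 'I_n * 'I_n}) : R :=
  \sum_(e in M) dist (p e.1) (p e.2).

Definition verts (n : nat) (M : {set 'I_n * 'I_n}) : {set 'I_n} :=
  [set v | [exists e in M, (e.1 == v) || (e.2 == v)]].

Definition max_matching (R : realType) (n : nat) (p : 'I_n -> R * R)
  (S : {set 'I_n}) (M : {set 'I_n * 'I_n}) : Prop :=
  perfect_matching S M /\
  forall M', perfect_matching S M' -> weight p M' <= weight p M.

Definition local_max (R : realType) (n : nat) (p : 'I_n -> R * R) (k : nat)
  (M : {set 'I_n * 'I_n}) : Prop :=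
  forall M' : {set 'I_n * 'I_n}, M' \subset M -> (#|M'| <= k)%N -> max_matching p (verts M') M'.

(* Main.v *)
Require Import Defs.
From HB Require Import structures.
From mathcomp Require Import all_boot all_order all_algebra.
From mathcomp Require Import ring lra zify.
From mathcomp Require Import boolp classical_sets reals topology normedtype derive realfun trigo.
Set Implicit Arguments. Unset Strict Implicit. Unset Printing Implicit Defensive.
Import Order.TTheory GRing.Theory Num.Theory.
Import numFieldNormedType.Exports.
Local Open Scope ring_scope.

(** A point [o] with [|a o| + |b o| <= (2 / sqrt 3) |a b|] for every edge [ab]
    of [M] suffices: summing over [M] bounds [w M], while
    [w Mstar <= \sum_v |v o|] by the triangle inequality.

    Take [o] minimising the largest excess
    [|a o| + |b o| - (2 / sqrt 3) |a b|], and suppose that it is positive.  By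
    first-order optimality the bisectors of the angles [a o b] of the edges
    attaining the maximum lie in no open half-plane, so two of them are
    opposite or three of them go around [o] with gaps at most [pi].  A positive
    excess forces the angle [a o b] to be less than [2 pi / 3].  Swapping the
    ends of two of these edges, or rotating the ends of all three, then yields
    a strictly longer matching, against 3-local maximality.

    The length of a rematching is bounded below by projecting each new edge on
    a well-chosen direction.  This reduces the comparison to one inequality per
    old edge, and leaves a linear problem on angles. *)

(** The ratio [sqrt3 / 2] is the cosine of [pi6]: an edge with positive excess is shorter than its
    share as soon as both its ends are projected at angles at most [pi6]. This square of angles
    settles every position of three bisectors except the one called [tall], which is the obstacle
    that shapes the proof. There, pairs of angles outside the square are required, and which ones
    are admissible depends on which end is longer and on how wide the edge is seen. For a given edge
    the admissible pairs with both angles in the first quadrant form a convex region, so a few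
    extreme pairs ([beats_corner], [beats_0], [beats_tilt], [beats_steep]) and interpolation between
    them are enough. Measuring angles in units of [pi6] makes nearly all remaining conditions
    linear. *)

HB.lock Definition sqrt3 {R : realType} : R := Num.sqrt 3.
HB.lock Definition pi6 {R : realType} : R := pi / 6.

(** * Trigonometry *)

Section Trig.
Local Open Scope classical_set_scope.
Local Open Scope ring_scope.
Variable R : realType.
Implicit Types (a b x y l : R).

Lemma sqrt3_sq : sqrt3 * sqrt3 = 3 :> R.
Proof. by rewrite sqrt3.unlock -expr2 sqr_sqrtr // ler0n. Qed.

Lemma sqrt3_gt0 : 0 < sqrt3 :> R.
Proof. by rewrite sqrt3.unlock sqrtr_gt0 ltr0n. Qed.

Lemma sqrt3_bounds : (173 / 100 < sqrt3 :> R) /\ (sqrt3 < 174 / 100 :> R).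
Proof. by have := sqrt3_sq; have := sqrt3_gt0; split; nra. Qed.

Lemma pi6_gt0 : 0 < pi6 :> R.
Proof. by rewrite pi6.unlock divr_gt0 // pi_gt0. Qed.

Lemma pi_pi6 : pi = 6 * pi6 :> R.
Proof. by rewrite pi6.unlock; field. Qed.

(** The triple-angle formula [cos (3 * x) = cos x * (1 - 4 * sin x ^+ 2)] vanishes at [x = pi6],
    where [cos x] is positive. *)
Lemma sin_pi6 : sin pi6 = 1 / 2 :> R.
Proof.
have h0 := pi6_gt0.
have c0 : 0 < cos (pi6 : R) by apply: cos_gt0_pihalf; rewrite pi_pi6; lra.
have e1 : sin (pi6 + pi6 + pi6 : R) = 1.
  by rewrite -sin_pihalf pi_pi6; congr sin; field.
have e2 : cos (pi6 + pi6 + pi6 : R) = 0.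
  by rewrite -cos_pihalf pi_pi6; congr cos; field.
have sc := cos2Dsin2 (pi6 : R).
move: e2 e1; rewrite sinD cosD sinD cosD => e2 e1.
have s0 : 0 < sin (pi6 : R) by apply: sin_gt0_pi; rewrite pi_pi6; lra.
have : cos (pi6 : R) * (cos pi6 ^+ 2 + sin pi6 ^+ 2 - 4 * (sin pi6 * sin pi6)) =
  0.
  by rewrite -[RHS]e2; ring.
rewrite sc; move/eqP; rewrite mulf_eq0 (gt_eqF c0) /= => /eqP; nra.
Qed.

Lemma cos_pi6 : cos pi6 = sqrt3 / 2 :> R.
Proof.
have h0 := pi6_gt0; have r0 := sqrt3_gt0; have rr := sqrt3_sq.
have c0 : 0 < cos (pi6 : R) by apply: cos_gt0_pihalf; rewrite pi_pi6; lra.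
have := cos2Dsin2 (pi6 : R); rewrite sin_pi6 => e; nra.
Qed.

Lemma cos_2pi6 : cos (2 * pi6) = 1 / 2 :> R.
Proof.
have -> : 2 * pi6 = pi6 + pi6 :> R by ring.
by rewrite cosD sin_pi6 cos_pi6; have := sqrt3_sq; lra.
Qed.

Lemma sin_2pi6 : sin (2 * pi6) = sqrt3 / 2 :> R.
Proof.
have -> : 2 * pi6 = pi6 + pi6 :> R by ring.
by rewrite sinD sin_pi6 cos_pi6; lra.
Qed.

Lemma cos_le a b : `|a| <= `|b| -> `|b| <= 6 * pi6 -> cos b <= cos a.
Proof.
move=> ab b6; rewrite -(cos_norm a) -(cos_norm b) leNgt.
rewrite ltr_cos -?leNgt // in_itv /= normr_ge0 pi_pi6 //=.
exact: le_trans ab b6.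
Qed.

Lemma sin_le a b : - (3 * pi6) <= a -> a <= b -> b <= 3 * pi6 -> sin a <= sin b.
Proof.
move=> a3 ab b3; rewrite leNgt ltr_sin -?leNgt // in_itv /= pi_pi6; lra.
Qed.

Lemma cos_MVT a b : a < b -> 0 <= a -> b <= 3 * pi6 ->
  exists2 c, a <= c <= b & cos b - cos a = - sin c * (b - a).
Proof.
move=> ab a0 b3.
have dcos : forall x, x \in `]a, b[%R -> is_derive x 1 cos (- sin x).
  by move=> x _; exact: is_derive_cos.
have ccos : {within `[a, b], continuous (@cos R)}.
  by apply: continuous_subspaceT => x; exact: continuous_cos.
have [c cab ->] := MVT ab dcos ccos.
by exists c => //; move: cab; rewrite in_itv /=; lra.
Qed.

(** The slopes of the chords on the two sides of the intermediate point are [- sin u] and [- sin v]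
    with [u <= v], and [sin] increases on this range. *)
Lemma cos_concave a b l : 0 <= a <= 3 * pi6 -> 0 <= b <= 3 * pi6 ->
  0 <= l <= 1 ->
  (1 - l) * cos a + l * cos b <= cos ((1 - l) * a + l * b).
Proof.
wlog ab : a b l / a <= b.
  move=> H a3 b3 l1; case: (leP a b) => ab; first exact: H.
  have := H b a (1 - l) (ltW ab) b3 a3.
  have -> : (1 - (1 - l)) * b + (1 - l) * a = (1 - l) * a + l * b by ring.
  have -> : (1 - (1 - l)) * cos b + (1 - l) * cos a =
    (1 - l) * cos a + l * cos b by ring.
  by apply; lra.
move=> a3 b3 l1.
have [->|l0] := eqVneq l 0; first by rewrite subr0 !mul0r !mul1r !addr0.
have [->|l1'] := eqVneq l 1; first by rewrite subrr !mul0r !mul1r !add0r.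
have lp : 0 < l by rewrite lt_def l0; lra.
have lq : 0 < 1 - l by rewrite subr_gt0 lt_def eq_sym l1'; lra.
case: (ltgtP a b) ab => // [ab _|-> _]; last first.
  by rewrite -!mulrDl (_ : 1 - l + l = 1) ?mul1r //; ring.
set c := _ * a + _.
have ac : a < c by rewrite /c; nra.
have cb : c < b by rewrite /c; nra.
have [||u u1 eu] := cos_MVT ac; [lra|lra|].
have [||v v1 ev] := cos_MVT cb; [lra|lra|].
have suv : sin u <= sin v.
  rewrite leNgt ltr_sin -?leNgt; first by lra.
  - by rewrite in_itv /= pi_pi6; lra.
  - by rewrite in_itv /= pi_pi6; lra.
have e1 : c - a = l * (b - a) by rewrite /c; ring.
have e2 : b - c = (1 - l) * (b - a) by rewrite /c; ring.
rewrite e1 in eu; rewrite e2 in ev.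
have K : 0 <= l * (1 - l) * (b - a) * (sin v - sin u).
  by rewrite !mulr_ge0 //; lra.
have {}eu : (1 - l) * (cos c - cos a) = - (l * (1 - l) * (b - a) * sin u).
  by rewrite eu; ring.
have {}ev : l * (cos b - cos c) = - (l * (1 - l) * (b - a) * sin v).
  by rewrite ev; ring.
move: K eu ev; rewrite mulrBr; lra.
Qed.
End Trig.

(** * One edge seen from a point *)

Section Edges.
Variable R : realType.
Implicit Types (a b x y l p q th : R).

(* An edge is seen from [o] at the angle [2 * th], its ends being at distances
   [p] and [q]; [sqlen] is its squared length (law of cosines), and [uncovered]
   says that [o] is outside its ellipse of eccentricity [sqrt3 / 2]. *)
Definition sqlen p q th : R := p ^+ 2 + q ^+ 2 - 2 * p * q * cos (2 * th).

Definition uncovered p q th :=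
  [/\ 0 < p, 0 < q, 0 <= th, th < 2 * pi6 &
    sqlen p q th < 3 / 4 * (p + q) ^+ 2].

(* [a] and [b] are the angles between the ends, seen from [o], and the
   directions on which the new edges at these ends get projected: the edge is
   shorter than its share of the rematching. *)
Definition beats p q th a b := Num.sqrt (sqlen p q th) < p * cos a + q * cos b.

Lemma uncoveredC p q th : uncovered p q th -> uncovered q p th.
Proof.
case=> p0 q0 t0 t2 E; split => //.
rewrite (_ : sqlen q p th = sqlen p q th); last by rewrite /sqlen; ring.
by rewrite (addrC q).
Qed.

Lemma beatsC p q th a b : beats p q th a b -> beats q p th b a.
Proof.
rewrite /beats (_ : sqlen q p th = sqlen p q th); last by rewrite /sqlen; ring.
by rewrite addrC.
Qed.

Lemma sqrt_ltP x y : 0 < y -> x < y ^+ 2 -> Num.sqrt x < y.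
Proof.
move=> y0 xy; rewrite -(ger0_norm (ltW y0)) -sqrtr_sqr ltr_sqrt //.
by rewrite exprn_gt0.
Qed.

Lemma beats_sqr p q th a b : 0 < p * cos a + q * cos b ->
  sqlen p q th < (p * cos a + q * cos b) ^+ 2 -> beats p q th a b.
Proof. exact: sqrt_ltP. Qed.

Lemma beats_le p q th a b a' b' : uncovered p q th -> beats p q th a b ->
  `|a'| <= `|a| -> `|b'| <= `|b| -> `|a| <= 6 * pi6 -> `|b| <= 6 * pi6 ->
  beats p q th a' b'.
Proof.
case=> p0 q0 _ _ _ + /cos_le ca /cos_le cb /ca {}ca /cb {}cb.
by move/lt_le_trans; apply; rewrite lerD // ler_pM2l.
Qed.

(** By concavity of [cos] on the first quadrant, the admissible pairs of angles there form a convex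
    set; together with [beats_le], a pair below a segment joining two admissible pairs is
    admissible. *)
Lemma beats_convex p q th a b a' b' l : uncovered p q th -> 0 <= l <= 1 ->
  beats p q th a b -> beats p q th a' b' ->
  0 <= a <= 3 * pi6 -> 0 <= b <= 3 * pi6 -> 0 <= a' <= 3 * pi6 ->
    0 <= b' <= 3 * pi6 ->
  beats p q th ((1 - l) * a + l * a') ((1 - l) * b + l * b').
Proof.
case=> p0 q0 _ _ _ l1; rewrite /beats;
  set e := Num.sqrt _ => E E' a1 b1 a1' b1'.
have := cos_concave b1 b1' l1; have := cos_concave a1 a1' l1.
set ca := cos (_ + _) => A; set cb := cos (_ + _) => B.
have : (1 - l) * e + l * e < (1 - l) * (p * cos a + q * cos b) + l * (p * cos a'
  + q * cos b').
  have [->|l0] := eqVneq l 0; first by lra.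
  have lp : 0 < l by rewrite lt_def l0; lra.
  have q1 : (1 - l) * e <= (1 - l) * (p * cos a + q * cos b).
    by apply: ler_wpM2l; [lra | exact: ltW].
  have q2 : l * e < l * (p * cos a' + q * cos b') by rewrite ltr_pM2l.
  by lra.
have : p * ((1 - l) * cos a + l * cos a') <= p * ca by rewrite ler_pM2l.
have : q * ((1 - l) * cos b + l * cos b') <= q * cb by rewrite ler_pM2l.
by lra.
Qed.

(** Since [cos pi6 = sqrt3 / 2], this is the inequality in [uncovered] itself. *)
Lemma beats_corner p q th : uncovered p q th -> beats p q th pi6 pi6.
Proof.
have := sqrt3_sq R; have := sqrt3_gt0 R => r0 rr.
case=> p0 q0 _ _ E; apply: beats_sqr; rewrite cos_pi6; first by nra.
have -> : (p * (sqrt3 / 2) + q * (sqrt3 / 2)) ^+ 2 = sqrt3 * sqrt3 / 4 * (p + q)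
  ^+ 2.
  by field.
by rewrite rr.
Qed.

Lemma beats_square p q th a b : uncovered p q th -> `|a| <= pi6 ->
  `|b| <= pi6 ->
  beats p q th a b.
Proof.
move=> E ah bh; have h0 := pi6_gt0 R.
have hn : `|pi6| = pi6 :> R by rewrite gtr0_norm.
by apply: (beats_le E (beats_corner E)); rewrite hn //; lra.
Qed.

(** Put [psi = 2 * pi6 - th]. For [p = q] the two sides at the extreme [b] are [2 * q * sin th] and
    [2 * q * cos psi ^+ 2], so the claim is [sin th < cos psi ^+ 2]. In general, the difference of
    the squares gains a nonnegative term in [p - q]. *)
Lemma beats_0 p q th b : uncovered p q th -> q <= p ->
  `|b| <= 4 * pi6 - 2 * th ->
  beats p q th 0 b.
Proof.
move=> E qp bt; have h0 := pi6_gt0 R; have r0 := sqrt3_gt0 R;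
  have rr := sqrt3_sq R.
case: (E) => p0 q0 t0 t2 _.
suff : beats p q th 0 (4 * pi6 - 2 * th).
  move/(beats_le E); apply; rewrite ?normr0 //; last 2 first.
  - by lra.
  - by rewrite ger0_norm; lra.
  - by rewrite (@ger0_norm _ (_ - _)); lra.
set psi := 2 * pi6 - th.
have -> : 4 * pi6 - 2 * th = psi + psi by rewrite /psi; ring.
have sp : 0 < sin psi by apply: sin_gt0_pi; rewrite pi_pi6 /psi; lra.
have cp : 0 < cos psi by apply: cos_gt0_pihalf; rewrite pi_pi6 /psi; lra.
have sc := cos2Dsin2 psi.
have st : sin th = sqrt3 / 2 * cos psi - 1 / 2 * sin psi.
  have -> : th = 2 * pi6 - psi by rewrite /psi; ring.
  by rewrite sinB sin_2pi6 cos_2pi6.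
have st0 : 0 <= sin th by apply: sin_ge0_pi; rewrite pi_pi6; lra.
have c2t : cos (2 * th) = 1 - 2 * sin th ^+ 2.
  by have := cos2Dsin2 th; rewrite mulrDl !mul1r cosD; nra.
have c2p : cos (psi + psi) = 2 * cos psi ^+ 2 - 1 by rewrite cosD; nra.
have key : sin th < cos psi ^+ 2.
  (* When [cos psi >= sqrt3 / 2], its square dominates [sqrt3 / 2 * cos psi]. Otherwise
     [sin psi > 1 / 2] and the difference exceeds [(cos psi - sqrt3 / 4) ^+ 2 + 1 / 16]. *)
  rewrite st; case: (leP (sqrt3 / 2) (cos psi)) => cr; first by nra.
  have s12 : 1 / 2 < sin psi by nra.
  have : 0 <= (cos psi - sqrt3 / 4) ^+ 2 by exact: sqr_ge0.
  by nra.
have c1 := cos_le1 psi.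
rewrite /beats; apply: sqrt_ltP; rewrite cos0 c2p; first by nra.
rewrite /sqlen c2t -subr_gt0.
set u := cos psi ^+ 2 in key *; set s := sin th in key st0 *.
have s1 : s <= 1 by exact: sin_le1.
have us : 0 <= 2 * u - 2 * s ^+ 2 by nra.
have us2 : 0 < (2 * u) ^+ 2 - 4 * s ^+ 2 by nra.
have -> : (p * 1 + q * (2 * u - 1)) ^+ 2 -
    (p ^+ 2 + q ^+ 2 - 2 * p * q * (1 - 2 * s ^+ 2)) =
  2 * (q * (p - q)) * (2 * u - 2 * s ^+ 2) +
    q ^+ 2 * ((2 * u) ^+ 2 - 4 * s ^+ 2) by ring.
apply: ltr_wpDl; last by rewrite mulr_gt0 // exprn_gt0.
by rewrite mulr_ge0 // mulr_ge0 // mulr_ge0; lra.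
Qed.
End Edges.

(* Any angle strictly between [pi6] and [2 * pi6] for which [beats_tilt] and
   [beats_steep] both hold would do. *)
HB.lock Definition acos45 {R : realType} : R := acos (4 / 5).

(** * Two further extreme pairs of projection angles *)

Section Tilts.
Variable R : realType.
Implicit Types (a b x y l p q th : R).

Lemma cos_acos45 : cos acos45 = 4 / 5 :> R.
Proof. by rewrite acos45.unlock acosK // in_itv /=; lra. Qed.

Lemma acos45_bounds : pi6 < (acos45 : R) < 2 * pi6.
Proof.
have h0 := pi6_gt0 R; have [rl ru] := sqrt3_bounds R; have c := cos_acos45.
have b : -1 <= (4 / 5 : R) <= 1 by lra.
have v00 : 0 <= acos45 :> R by rewrite acos45.unlock; exact: acos_ge0.
have v06 : acos45 <= 6 * pi6 :> R by rewrite acos45.unlock -pi_pi6;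
  exact: acos_lepi.
apply/andP; split; rewrite ltNge; apply/negP => vh.
- have : cos pi6 <= cos acos45 :> R by apply: cos_le; rewrite !ger0_norm; lra.
  by rewrite cos_pi6; lra.
- have : cos acos45 <= cos (2 * pi6) :> R by apply: cos_le; rewrite !ger0_norm;
    lra.
  by rewrite cos_2pi6; lra.
Qed.

Lemma sin_acos45 : sin acos45 = 3 / 5 :> R.
Proof.
have h0 := pi6_gt0 R; have /andP[b1 b2] := acos45_bounds.
have : 0 <= sin (acos45 : R) by apply: sin_ge0_pi; rewrite pi_pi6; lra.
by have := cos2Dsin2 (acos45 : R); rewrite cos_acos45; nra.
Qed.

(** As [cos (2 * pi6 - acos45) < 1], the inequality would fail for [p] much larger than [q];
    [uncovered] bounds the ratio [p / q], in the form [e1]. *)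
Lemma beats_tilt p q th : uncovered p q th -> q <= p -> th <= pi6 ->
  beats p q th (2 * pi6 - acos45) (2 * pi6).
Proof.
move=> E qp th1; have h0 := pi6_gt0 R; have [rl ru] := sqrt3_bounds R.
have rr := sqrt3_sq R; case: (E) => p0 q0 t0 t2 F.
have C1 : 1 / 2 <= cos (2 * th).
  by rewrite -cos_2pi6; apply: cos_le; rewrite !ger0_norm; lra.
have C2 : cos (2 * th) <= 1 by exact: cos_le1.
apply: beats_sqr; rewrite cosB cos_2pi6 sin_2pi6 cos_acos45 sin_acos45;
  first by nra.
move: F; rewrite /sqlen; set C := cos _ in C1 C2 *.
set A := 1 / 2 * (4 / 5) + sqrt3 / 2 * (3 / 5).
have A1 : 11 / 12 < A by rewrite /A; lra.
have A2 : 84 / 100 < A ^+ 2 by nra.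
move: A A1 A2 => A A1 A2 F.
have pq := mulr_gt0 p0 q0.
have e1 : p ^+ 2 + q ^+ 2 <= p * q * (6 + 8 * C) by nra.
rewrite -subr_gt0.
have -> : (p * A + q * (1 / 2)) ^+ 2 - (p ^+ 2 + q ^+ 2 - 2 * p * q * C) =
  p ^+ 2 * (A ^+ 2 - 1) + p * q * (A + 2 * C) - 3 / 4 * q ^+ 2 by field.
have p2 : 0 <= p ^+ 2 * (A ^+ 2 - 84 / 100) by rewrite mulr_ge0 ?sqr_ge0; lra.
have pA : 0 <= p * q * (A - 11 / 12) by rewrite mulr_ge0; lra.
have pC : 0 <= p * q * (C - 1 / 2) by rewrite mulr_ge0; lra.
(* The loss [p ^+ 2 * (1 - A ^+ 2)] is compared with [p * q] directly when [p <= 4 * q]. Beyond that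
   [e1] bounds it, and [q ^+ 2] is small against [p * q]. *)
case: (leP p (4 * q)) => p4.
- have : p ^+ 2 <= 4 * (p * q) by nra.
  have : q ^+ 2 <= p * q by nra.
  by nra.
- have : 4 * q ^+ 2 <= p * q by nra.
  by nra.
Qed.

(** For [c = cos y] and [s = sin y], [m] is [2 * (cos (acos45 - y) - cos (2 * pi6 + y))], [t] is
    [sin (acos45 - y) ^+ 2], and the first factor [Q] is the bound on [p / q + q / p] given by
    [uncovered] at half-angle [2 * pi6 - y / 2]. The proof compares [(Q - 2) * (m * t)] with
    [(m - t) ^+ 2] through polynomial bounds in [s]: at [y = 0] the former vanishes while
    [m - t = 6 / 25]. *)
Lemma steep_discriminant (c s : R) (m :=
  2 * (3 / 10 * c + (3 / 5 + sqrt3 / 2) * s))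
    (t := (3 / 5 * c - 4 / 5 * s) ^+ 2) :
  c ^+ 2 + s ^+ 2 = 1 -> 0 <= s <= 1 / 8 -> 0 < c ->
  (6 - 4 * c + 4 * sqrt3 * s) * (m * t) <= m ^+ 2 + t ^+ 2.
Proof.
move=> sc /andP[s0 s1] c0; have [rl ru] := sqrt3_bounds R.
have cle : c <= 1 by nra.
have c1 : 1 - s ^+ 2 <= c by nra.
have rs1 : 173 / 100 * s <= sqrt3 * s by apply: ler_wpM2r => //; lra.
have rs2 : sqrt3 * s <= 174 / 100 * s by apply: ler_wpM2r => //; lra.
have m1 : m <= 3 / 5 + 3 * s by rewrite /m; lra.
have m0 : 0 <= m by rewrite /m; lra.
have t0 : 0 <= t by exact: sqr_ge0.
have ss : s ^+ 2 <= 1 / 8 * s by nra.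
have t1 : t <= (3 / 5 - 4 / 5 * s) ^+ 2 by rewrite /t ler_pXn2r ?nnegrE //; lra.
have D : 6 / 25 + 37 / 10 * s <= m - t.
  by have : 3 / 5 * (1 - s ^+ 2) + 293 / 100 * s <= m; [rewrite /m; lra | lra].
have Q2 : 4 - 4 * c + 4 * sqrt3 * s <= 15 / 2 * s by lra.
have M : m * t <= 11 / 50 + 1 / 2 * s.
  apply: (@le_trans _ _ ((3 / 5 + 3 * s) * (3 / 5 - 4 / 5 * s) ^+ 2)).
    by apply: ler_pM.
  have s3 : 0 <= s ^+ 2 * (1 - s) by rewrite mulr_ge0 ?sqr_ge0; lra.
  by lra.
have mt : 0 <= m * t by exact: mulr_ge0.
have A : (4 - 4 * c + 4 * sqrt3 * s) * (m * t) <= 15 / 2 * s * (11 / 50 + 1 / 2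
  * s).
  apply: (@le_trans _ _ (15 / 2 * s * (m * t))); first exact: ler_wpM2r.
  by apply: ler_wpM2l M; lra.
have B : (6 / 25 + 37 / 10 * s) ^+ 2 <= (m - t) ^+ 2.
  by rewrite ler_pXn2r ?nnegrE //; lra.
by move: A B; clearbody m t; nra.
Qed.

(** For wedges of nearly maximal width, where the second angle allowed by [beats_0] shrinks to [y],
    and whichever end is longer. After squaring, the claim reads [q * t < p * m]. *)
Lemma beats_steep p q y : uncovered p q (2 * pi6 - y / 2) ->
  0 <= y <= acos45 - pi6 ->
  beats p q (2 * pi6 - y / 2) 0 (acos45 - y).
Proof.
move=> E /andP[y0 yx]; have h0 := pi6_gt0 R; have [rl ru] := sqrt3_bounds R.
have rr := sqrt3_sq R; case: (E) => p0 q0 t0 t2 F.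
have /andP[v1 v2] := acos45_bounds.
set s := sin y; set c := cos y.
have s0 : 0 <= s by apply: sin_ge0_pi; rewrite pi_pi6; lra.
have c0 : 0 < c by apply: cos_gt0_pihalf; rewrite pi_pi6; lra.
have sc : c ^+ 2 + s ^+ 2 = 1 by exact: cos2Dsin2.
have s1 : s <= 1 / 8.
  have sx : sin (acos45 - pi6 : R) <= 1 / 8.
    by rewrite sinB sin_acos45 cos_acos45 sin_pi6 cos_pi6; lra.
  apply: le_trans sx; rewrite leNgt ltr_sin -?leNgt // in_itv /= pi_pi6; lra.
have c1 : 1 - s ^+ 2 <= c by nra.
have cle : c <= 1 by exact: cos_le1.
have cy : cos (2 * (2 * pi6 - y / 2)) = - (1 / 2 * c - sqrt3 / 2 * s).
  have -> : 2 * (2 * pi6 - y / 2) = 6 * pi6 - (2 * pi6 + y) by field.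
  by rewrite cosB -pi_pi6 cospi sinpi cosD cos_2pi6 sin_2pi6 /c /s; ring.
have cv : cos (acos45 - y) = 4 / 5 * c + 3 / 5 * s
  by rewrite cosB cos_acos45 sin_acos45.
have pq := mulr_gt0 p0 q0.
move: F; rewrite /sqlen cy => F.
apply: beats_sqr; rewrite cos0 cv; first by nra.
rewrite /sqlen cy.
set m := 2 * (3 / 10 * c + (3 / 5 + sqrt3 / 2) * s).
set t := (3 / 5 * c - 4 / 5 * s) ^+ 2.
set Q := 6 - 4 * c + 4 * sqrt3 * s.
have e1 : p ^+ 2 + q ^+ 2 < p * q * Q by rewrite /Q; nra.
rewrite -subr_gt0.
have -> : (p * 1 + q * (4 / 5 * c + 3 / 5 * s)) ^+ 2 -
    (p ^+ 2 + q ^+ 2 - 2 * p * q * - (1 / 2 * c - sqrt3 / 2 * s)) =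
  q * (p * m - q * t).
  rewrite /m /t.
  have -> : p ^+ 2 + q ^+ 2 = p ^+ 2 + q ^+ 2 * (c ^+ 2 + s ^+ 2)
    by rewrite sc mulr1.
  by field.
rewrite mulr_gt0 // subr_gt0 ltNge; apply/negP => H.
have t0' : 0 < t by rewrite /t exprn_gt0 //; nra.
have mt : t <= m by rewrite /t /m; nra.
have key : Q * (m * t) <= m ^+ 2 + t ^+ 2.
  by apply: steep_discriminant => //; rewrite s0.
have m0 : 0 < m by lra.
have pq' : p <= q by rewrite -(ler_pM2r m0); apply: le_trans H _;
  rewrite ler_pM2l.
(* [x |-> x ^+ 2 - Q * x + 1] is nonnegative at [m / t >= 1], negative at
   [q / p], and its two roots are inverse to each other. *)
have g : 0 <= q * m - p * t by rewrite subr_ge0; apply: ler_pM => //;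
  exact: ltW.
have k1 : 0 <= (q * t - p * m) * (q * m - p * t)
  by rewrite mulr_ge0 // subr_ge0.
have k2 : p * q * (Q * (m * t)) <= p * q * (m ^+ 2 + t ^+ 2)
  by rewrite ler_pM2l.
have k3 : 0 < (p * q * Q - (p ^+ 2 + q ^+ 2)) * (m * t).
  by rewrite mulr_gt0 ?subr_gt0 // mulr_gt0.
by lra.
Qed.
End Tilts.

(** * Rematching two or three edges *)

Section Certificates.
Variable R : realType.
Implicit Types (p q th a b w x y l eps : R).

(* An edge seen from [o]: if the bisector has direction [c], its ends are at
   distance [plus_len] in direction [c + half_angle] and at distance
   [minus_len] in direction [c - half_angle]. *)
Record wedge := Wedge { plus_len : R; minus_len : R; half_angle : R }.
Implicit Types e f g : wedge.

Definition mirror e := Wedge (minus_len e) (plus_len e) (half_angle e).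
Definition wuncovered e := uncovered (plus_len e) (minus_len e) (half_angle e).
Definition wbeats e a b := beats (plus_len e) (minus_len e) (half_angle e) a b.

(* [f] comes counterclockwise after [e], the bisectors making the angle
   [pi - eps].  [swap] joins plus ends together and minus ends together, [cross]
   joins plus ends to minus ends, and [triple] joins each minus end to the plus
   end of the next wedge.  The equations say that the directions at the two ends
   of each new edge are opposite. *)
Definition swap e f eps := exists a b a' b', [/\ wbeats e a b, wbeats f a' b',
  a' - a = eps - (half_angle f - half_angle e) &
    b - b' = eps + (half_angle f - half_angle e)].

Definition cross e f eps := exists a b a' b', [/\ wbeats e a b, wbeats f a' b',
  a + b' = - (eps + half_angle e + half_angle f) &
    a' + b = eps - half_angle e - half_angle f].

Definition triple e f g x y z := exists a b a' b' a'' b'',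
  [/\ wbeats e a b, wbeats f a' b', wbeats g a'' b'' &
  [/\ b + a' = x - half_angle e - half_angle f,
    b' + a'' = y - half_angle f - half_angle g &
      b'' + a = z - half_angle g - half_angle e]].

Lemma wuncovered_mirror e : wuncovered e -> wuncovered (mirror e).
Proof. exact: uncoveredC. Qed.

(** A reflection reverses the order of the wedges and exchanges plus and minus ends. *)
Lemma swap_mirror e f eps : swap (mirror f) (mirror e) eps -> swap e f eps.
Proof.
case=> a [b [a' [b' [/beatsC F /beatsC E /= h1 h2]]]].
by exists b', a', b, a; split => //; lra.
Qed.

Lemma cross_mirror e f eps : cross (mirror f) (mirror e) eps -> cross e f eps.
Proof.
case=> a [b [a' [b' [/beatsC F /beatsC E /= h1 h2]]]].
by exists b', a', b, a; split => //; lra.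
Qed.

(** Each of the two prescribed differences is split evenly between its ends, which keeps all four
    angles within [pi6]. *)
Lemma swap_square e f eps : wuncovered e -> wuncovered f -> 0 <= eps ->
  eps + `|half_angle f - half_angle e| <= 2 * pi6 -> swap e f eps.
Proof.
move=> E F e0 ef; set k := half_angle f - half_angle e in ef *.
have [k1 k2] : k <= `|k| /\ - k <= `|k| by rewrite ler_norm -normrN ler_norm.
exists (- ((eps - k) / 2)), ((eps + k) / 2), ((eps - k) / 2),
  (- ((eps + k) / 2)).
by split; rewrite -/k; try lra; apply: beats_square => //;
  rewrite ?normrN ler_norml; lra.
Qed.

Lemma beats_diag p q th w : uncovered p q th -> q <= p -> th <= pi6 ->
  0 <= w <= pi6 ->
  beats p q th w (2 * pi6 - w).
Proof.
move=> E qp th1 w1; have h0 := pi6_gt0 R;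
  have hN0 : pi6 != 0 :> R by rewrite gt_eqF.
have B0 : beats p q th 0 (2 * pi6).
  by apply: beats_0 => //; rewrite ger0_norm; lra.
have l1 : 0 <= w / pi6 <= 1 by rewrite divr_ge0 ?ler_pdivrMr //; lra.
have := beats_convex E l1 B0 (beats_corner E).
have -> : (1 - w / pi6) * 0 + w / pi6 * pi6 = w by field.
have -> : (1 - w / pi6) * (2 * pi6) + w / pi6 * pi6 = 2 * pi6 - w by field.
by apply; lra.
Qed.

(** The wedge [f] stays in the square of [beats_square]; the narrower wedge [e] absorbs the rest,
    its longer end keeping a small angle so that its shorter end may take a large one ([beats_0],
    [beats_diag]). *)
Lemma swap_good e f eps : wuncovered e -> wuncovered f ->
  minus_len e <= plus_len e ->
  half_angle e <= half_angle f -> 0 <= eps ->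
  eps <= half_angle f - half_angle e + pi6 \/
    half_angle e <= pi6 /\ eps <= 2 * pi6 -> swap e f eps.
Proof.
move=> E F me ef e0 H; have h0 := pi6_gt0 R.
case: (E) => _ _ te0 te2 _; case: (F) => _ _ tf0 tf2 _.
set k := half_angle f - half_angle e in H.
have k0 : 0 <= k by rewrite /k; lra.
case: (leP (eps + k) (2 * pi6)) => ek.
  by apply: swap_square => //; rewrite -/k (ger0_norm k0).
have hh : `|- pi6| <= pi6 :> R by rewrite normrN ger0_norm; lra.
case: (leP `|eps - k| pi6) => [|]; last first.
  case: (leP eps k) => ek2; last first.
    rewrite ger0_norm; last by lra.
    move=> ek3.
    have [h1 h2] : half_angle e <= pi6 /\ eps <= 2 * pi6.
      by case: H => // H; exfalso; lra.
    set w := eps - k - pi6.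
    have B := beats_diag (w := w) E me h1;
      exists (- w), (2 * k + w), pi6, (- pi6).
    split; rewrite -?/k /w; try lra.
    - have w1 : 0 <= w <= pi6 by rewrite /w; lra.
      have w2 : 0 <= 2 * pi6 - w by lra.
      have w3 : 0 <= 2 * k + w by lra.
      have w4 : 2 * k + w <= 2 * pi6 - w by rewrite /w; lra.
      apply: (beats_le E (B w1));
        rewrite ?normrN ?(ger0_norm w2) ?(ger0_norm w3) //.
      + by rewrite ger0_norm; lra.
      + by lra.
    - by apply: beats_square => //; rewrite ger0_norm; lra.
  rewrite ler0_norm; last by lra.
  move=> ek3; set w := k - eps - pi6.
  have B := beats_diag (w := w) E me; exists w, (2 * eps + w), (- pi6), (- pi6).
  split; rewrite -?/k /w; try lra.
  - have e1 : half_angle e <= pi6 by move: ek3; rewrite /k; lra.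
    have w1 : 0 <= w <= pi6 by move: ek3; rewrite /w /k; lra.
    have w2 : 0 <= 2 * pi6 - w by lra.
    have w3 : 0 <= 2 * eps + w by lra.
    have w4 : 2 * eps + w <= 2 * pi6 - w by move: e1; rewrite /w /k; lra.
    apply: (beats_le E (B e1 w1)); rewrite ?(ger0_norm w2) ?(ger0_norm w3) //.
    + by rewrite ger0_norm; lra.
    + by lra.
  - by apply: beats_square.
(* The second angle is at most [2 * k], hence below the bound [4 * pi6 - 2 * half_angle e] of
   [beats_0]. *)
move=> ek2; exists 0, (eps + k - pi6), (eps - k), (- pi6).
split; rewrite -?/k; try lra.
- apply: beats_0 => //; rewrite ger0_norm; last by lra.
  move: ek2; rewrite ler_norml => /andP[_ ek2].
  by move: ek2; rewrite /k; lra.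
- by apply: beats_square.
Qed.

(** The wide wedge [f] uses the pair at proportion [l = x / (acos45 - pi6)] between the corner and
    the pair of [beats_steep]. The last hypothesis says that its first angle [U], added to the [pi6]
    available at the plus end of [e], covers the required difference
    [2 * pi6 - 2 * half_angle e - x]. *)
Lemma swap_steep e f eps (x := eps + 2 * pi6 - half_angle e - half_angle f) :
  wuncovered e -> wuncovered f -> half_angle e <= pi6 ->
  2 * pi6 <= eps + (half_angle f - half_angle e) -> x <= acos45 - pi6 ->
  pi6 * x <= (acos45 - pi6) * (2 * half_angle e + x) -> swap e f eps.
Proof.
move=> E F e1 z0 xx0 xe; have h0 := pi6_gt0 R.
case: (E) => _ _ te0 te2 _; case: (F) => _ _ tf0 tf2 _.
have /andP[v1 v2] := acos45_bounds R.
set y := 4 * pi6 - 2 * half_angle f.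
have hf : half_angle f = 2 * pi6 - y / 2 by rewrite /y; field.
set x0 : R := acos45 - pi6 in xx0 xe.
have x00 : 0 < x0 by rewrite /x0; lra.
have x0N : x0 != 0 by rewrite gt_eqF.
have yx : y <= x by rewrite /x /y; lra.
have y0 : 0 <= y by rewrite /y; lra.
set l := x / x0.
have l1 : 0 <= l <= 1 by rewrite /l divr_ge0 ?ler_pdivrMr //; lra.
have lx : l * x0 = x by rewrite /l divfK.
have B : wbeats f ((1 - l) * pi6) (pi6 + x - l * y).
  rewrite /wbeats hf.
  have E1 : uncovered (plus_len f) (minus_len f) (2 * pi6 - y / 2)
    by rewrite -hf.
  have S1 : beats (plus_len f) (minus_len f) (2 * pi6 - y / 2) 0 (acos45 - y).
    by apply: beats_steep => //; rewrite -/x0; lra.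
  have := beats_convex E1 l1 (beats_corner E1) S1.
  have -> : (1 - l) * pi6 + l * 0 = (1 - l) * pi6 by ring.
  have -> : (1 - l) * pi6 + l * (acos45 - y) = pi6 + x - l * y.
    by rewrite -lx /x0; ring.
  by apply; rewrite -?/x0; move: xx0; rewrite /x0; lra.
set U := (1 - l) * pi6 in B.
have U0 : 0 <= U by rewrite /U mulr_ge0; lra.
have U1 : U <= pi6 by rewrite /U ler_piMl; lra.
have ly : l * y <= y by rewrite ler_piMl; lra.
have UC : pi6 - 2 * half_angle e - x <= U.
  rewrite -(ler_pM2r x00) /U.
  have -> : (1 - l) * pi6 * x0 = pi6 * x0 - pi6 * (l * x0) by ring.
  by rewrite lx; lra.
have W a : `|a| <= U -> wbeats f a (- (pi6 + x - y)).
  move=> aU; apply: (beats_le F B).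
  - by rewrite (ger0_norm U0).
  - by rewrite normrN !ger0_norm; lra.
  - by rewrite (ger0_norm U0); lra.
  - by rewrite ger0_norm; move: xx0; rewrite /x0; nra.
case: (leP (2 * pi6 - 2 * half_angle e - x) pi6) => C.
- exists (2 * pi6 - 2 * half_angle e - x), pi6, 0, (- (pi6 + x - y)); split.
  + apply: beats_square => //; first by rewrite ler_norml; move: xx0;
      rewrite /x0; lra.
    by rewrite ger0_norm; lra.
  + by apply: W; rewrite normr0.
  + by rewrite /x; lra.
  + by rewrite /x /y; lra.
- exists pi6, pi6, (pi6 - (2 * pi6 - 2 * half_angle e - x)), (- (pi6 + x - y));
    split.
  + by apply: beats_square => //; rewrite ger0_norm; lra.
  + by apply: W; rewrite ler_norml; lra.
  + by rewrite /x; lra.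
  + by rewrite /x /y; lra.
Qed.
End Certificates.

(** * Three edges around the point *)

Section Triples.
Variable R : realType.
Implicit Types (p q th a b s x y z eps : R) (e f g : wedge R).

(** The last hypothesis puts [(pi6 - x, s)] on or below the segment from the corner to the pair of
    [beats_tilt]. *)
Lemma beats_slide p q th x s : uncovered p q th -> q <= p -> th <= pi6 ->
  0 <= x <= acos45 - pi6 -> 0 <= s -> (acos45 - pi6) * (s - pi6) <= pi6 * x ->
  beats p q th (pi6 - x) s.
Proof.
move=> E qp th1 /andP[x0 xv] s0 sx; have h0 := pi6_gt0 R.
have /andP[v1 v2] := acos45_bounds R.
have w0 : 0 < acos45 - pi6 :> R by rewrite subr_gt0.
have l0 : 0 <= x / (acos45 - pi6) by rewrite divr_ge0 // ltW.
have l1 : x / (acos45 - pi6) <= 1 by rewrite ler_pdivrMr // mul1r.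
set l := x / _ in l0 l1.
have lx : l * (acos45 - pi6) = x by rewrite /l divfK ?gt_eqF.
have lb : 0 <= l <= 1 by rewrite l0.
have := beats_convex E lb (beats_corner E) (beats_tilt E qp th1).
have -> : (1 - l) * pi6 + l * (2 * pi6 - acos45) = pi6 - x by rewrite -lx; ring.
have -> : (1 - l) * pi6 + l * (2 * pi6) = pi6 + l * pi6 by ring.
have sl : s <= pi6 + l * pi6.
  rewrite -lerBlDl -(ler_pM2r w0) -mulrA (mulrC pi6) mulrA lx.
  by rewrite mulrC (mulrC x).
have lh : l * pi6 <= pi6 by rewrite ler_piMl // ltW.
have lh0 : 0 <= l * pi6 by rewrite mulr_ge0 // ltW.
clear sx; move=> B; apply: (beats_le E (B _ _ _ _)) => //; try lra.
- by rewrite ger0_norm // ger0_norm; lra.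
- by rewrite ger0_norm; lra.
- by rewrite ger0_norm; lra.
Qed.

Lemma beats_minus_tilt e s b : wuncovered e -> plus_len e <= minus_len e ->
  half_angle e <= pi6 ->
  0 <= s <= 2 * pi6 -> `|b| <= 2 * pi6 - acos45 -> wbeats e (- s) b.
Proof.
move=> /uncoveredC E pm e1 /andP[s0 s2] bv; have h0 := pi6_gt0 R.
have /andP[v1 v2] := acos45_bounds R;
  have w0 : 0 <= 2 * pi6 - acos45 :> R by lra.
apply: beatsC; apply: (beats_le E (beats_tilt E pm e1)).
- by rewrite (ger0_norm w0).
- by rewrite normrN !ger0_norm; lra.
- by rewrite (ger0_norm w0); lra.
- by rewrite ger0_norm; lra.
Qed.

Lemma cross_of e f eps b a' : wuncovered f -> `|a'| <= pi6 ->
  a' + b = eps - half_angle e - half_angle f ->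
  wbeats e (- (eps + half_angle f + half_angle e - pi6)) b -> cross e f eps.
Proof.
move=> F a'h ab B; have h0 := pi6_gt0 R.
exists (- (eps + half_angle f + half_angle e - pi6)), b, a', (- pi6);
  split => //; last by lra.
by apply: beats_square => //; rewrite normrN ger0_norm // ltW.
Qed.

(** Here the longer end of [e] is on the far side from [f]. For small [x], the condition of
    [swap_steep] and that of [beats_slide] complement each other: if the former fails, then
    [s - pi6 <= 2 * half_angle e + x] gives the latter, and with it a [cross]. *)
Lemma swap_or_cross e f eps : wuncovered e -> wuncovered f ->
  plus_len e <= minus_len e ->
  half_angle e <= half_angle f ->
    2 * pi6 <= eps + (half_angle f - half_angle e) -> eps <= 2 * pi6 ->
  eps + half_angle f + half_angle e <= 3 * pi6 -> swap e f eps \/ cross e f eps.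
Proof.
move=> E F pm ef z0 e2 t1; have h0 := pi6_gt0 R.
have hh : `|pi6| <= pi6 :> R by rewrite ger0_norm // ltW.
have hNh : `|- pi6| <= pi6 :> R by rewrite normrN.
case: (E) => _ _ te0 _ _; case: (F) => _ _ _ tf2 _.
have /andP[v1 v2] := acos45_bounds R.
have e1 : half_angle e <= pi6 by lra.
pose x := eps + 2 * pi6 - half_angle e - half_angle f.
pose s := eps + half_angle f + half_angle e - pi6.
have xE : eps - half_angle e - half_angle f = x - 2 * pi6 by rewrite /x; ring.
have s2 : pi6 <= s <= 2 * pi6 by rewrite /s; lra.
have s02 : 0 <= s <= 2 * pi6 by lra.
have x0 : 0 <= x by rewrite /x; lra.
have sx : s - pi6 <= 2 * half_angle e + x by rewrite /s /x; lra.
have xs : x - 3 * pi6 <= 2 * pi6 - s by rewrite /x /s; lra.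
have XC b a' : `|a'| <= pi6 -> a' + b = x - 2 * pi6 -> wbeats e (- s) b ->
  cross e f eps.
  by rewrite -xE; exact: cross_of.
have steep : x <= acos45 - pi6 ->
  pi6 * x <= (acos45 - pi6) * (2 * half_angle e + x) -> swap e f eps.
  exact: swap_steep.
clearbody x s; clear xE z0 t1 e2 ef tf2.
case: (leP x pi6) => xh.
  case: (leP x (acos45 - pi6)) => xv; last first.
    right; apply: (XC (x - pi6) (- pi6)) => //; first by ring.
    by apply: beats_minus_tilt => //; rewrite ler0_norm; lra.
  case: (leP (pi6 * x) ((acos45 - pi6) * (2 * half_angle e + x))) => xe.
    by left; apply: steep.
  right; apply: (XC (x - pi6) (- pi6)) => //; first by ring.
  have B : beats (minus_len e) (plus_len e) (half_angle e) (pi6 - x) s.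
    apply: beats_slide => //; [exact: uncoveredC | lra | lra |].
    by apply: le_trans (ltW xe); apply: ler_wpM2l => //; lra.
  apply: beatsC; apply: (beats_le (uncoveredC E) B).
  - by rewrite -normrN opprB.
  - by rewrite normrN.
  - by rewrite ger0_norm; lra.
  - by rewrite ger0_norm; lra.
right; case: (leP x (3 * pi6)) => xh3.
  apply: (XC 0 (x - 2 * pi6)); [by rewrite ler_norml; lra | by rewrite addr0 |].
  by apply: beats_minus_tilt => //; rewrite normr0; lra.
apply: (XC (x - 3 * pi6) pi6) => //; first by ring.
have w1 : 0 <= 2 * pi6 - s <= pi6 by lra.
apply: beatsC; apply: (beats_le (uncoveredC E) (beats_diag (uncoveredC E) pm e1
  w1)).
+ by rewrite !ger0_norm; lra.
+ by rewrite normrN !ger0_norm; lra.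
+ by rewrite ger0_norm; lra.
+ by rewrite ger0_norm; lra.
Qed.

(** The second angle takes as much of the sum as [pi6] allows, and the first only makes up a deficit
    of [pi6 - x]. *)
Lemma triple_arm x b0 : 0 <= x <= 3 * pi6 -> 0 <= b0 -> pi6 - x <= b0 ->
  exists b a, [/\ `|b| <= b0, `|a| <= pi6 & b + a = x - 2 * pi6 :> R].
Proof.
move=> /andP[x0 x3] b00 xb; have h0 := pi6_gt0 R.
case: (leP x pi6) => xh.
  exists (x - pi6), (- pi6); split; last by lra.
  - by rewrite ler0_norm; lra.
  - by rewrite normrN ger0_norm; lra.
exists 0, (x - 2 * pi6); split; last by lra.
- by rewrite normr0.
- by rewrite ler_norml; lra.
Qed.

(** The new edge between [g] and [e] joins their shorter ends. For a wedge of half-angle at most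
    [pi6], the tilted pair lets that end turn by [2 * pi6] instead of [pi6], at the price of a range
    of only [2 * pi6 - acos45] at the longer end; [f] compensates for this through [triple_arm]. *)
Lemma triple_tilt e f g x y z :
  wuncovered e -> wuncovered f -> wuncovered g ->
    plus_len e <= minus_len e -> minus_len g <= plus_len g ->
  half_angle e <= pi6 \/ half_angle g <= pi6 ->
  0 <= x + 2 * pi6 - half_angle e - half_angle f <= 3 * pi6 ->
  0 <= y + 2 * pi6 - half_angle f - half_angle g <= 3 * pi6 ->
  (half_angle e <= pi6 -> acos45 - pi6 <= x + 2 * pi6 - half_angle e -
    half_angle f) ->
  (half_angle g <= pi6 -> acos45 - pi6 <= y + 2 * pi6 - half_angle f -
    half_angle g) ->
  0 <= z - half_angle g - half_angle e <= 4 * pi6 ->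
  half_angle e <= pi6 /\ half_angle g <= pi6 \/
    z - half_angle g - half_angle e <= 3 * pi6 ->
  triple e f g x y z.
Proof.
move=> E F G pe pg eg x3 y3 xv yv z4 zz; have h0 := pi6_gt0 R.
have /andP[v1 v2] := acos45_bounds R.
have E' := uncoveredC E.
have Be a b : half_angle e <= pi6 -> `|b| <= 2 * pi6 - acos45 ->
  `|a| <= 2 * pi6 -> wbeats e a b.
  move=> e1 b1 a1; apply: beatsC; apply: (beats_le E' (beats_tilt E' pe e1)).
  - by rewrite (ger0_norm (_ : 0 <= 2 * pi6 - acos45)) //; lra.
  - by rewrite (@ger0_norm _ (2 * pi6)) //; lra.
  - by rewrite ger0_norm; lra.
  - by rewrite ger0_norm; lra.
have Bg a b : half_angle g <= pi6 -> `|a| <= 2 * pi6 - acos45 ->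
  `|b| <= 2 * pi6 -> wbeats g a b.
  move=> e1 b1 a1; apply: (beats_le G (beats_tilt G pg e1)).
  - by rewrite (ger0_norm (_ : 0 <= 2 * pi6 - acos45)) //; lra.
  - by rewrite (@ger0_norm _ (2 * pi6)) //; lra.
  - by rewrite ger0_norm; lra.
  - by rewrite ger0_norm; lra.
set be := if half_angle e <= pi6 then 2 * pi6 - acos45 else pi6 : R.
set bg := if half_angle g <= pi6 then 2 * pi6 - acos45 else pi6 : R.
have [||b [a' [b1 a1 s1]]] := triple_arm (b0 := be) x3.
  - by rewrite /be; case: ifP; lra.
  - by rewrite /be; case: ifP => [/xv|_]; lra.
have [||a'' [b' [b2 a2 s2]]] := triple_arm (b0 := bg) y3.
  - by rewrite /bg; case: ifP; lra.
  - by rewrite /bg; case: ifP => [/yv|_]; lra.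
have Bf : wbeats f a' b' by exact: beats_square.
have {}s1 : b + a' = x - half_angle e - half_angle f by rewrite s1; ring.
have {}s2 : b' + a'' = y - half_angle f - half_angle g by rewrite addrC s2;
  ring.
clear x3 y3 xv yv E' v1 v2.
set E3 := z - half_angle g - half_angle e in z4 zz.
have hh : `|pi6| <= pi6 :> R by rewrite ger0_norm; lra.
move: b1 b2; rewrite /be /bg; case: (leP (half_angle e) pi6) => eh;
  case: (leP (half_angle g) pi6) => gh b1 b2.
- have E32 : `|E3 / 2| <= 2 * pi6 by rewrite ger0_norm; lra.
  exists (E3 / 2), b, a', b', a'', (E3 / 2); split => //.
  + exact: Be.
  + exact: Bg.
  + by split => //; rewrite -/E3; field.
- have E32 : `|E3 - pi6| <= 2 * pi6 by rewrite ler_norml; lra.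
  exists (E3 - pi6), b, a', b', a'', pi6; split => //.
  + exact: Be.
  + exact: beats_square.
  + by split => //; rewrite -/E3; ring.
- have E32 : `|E3 - pi6| <= 2 * pi6 by rewrite ler_norml; lra.
  exists pi6, b, a', b', a'', (E3 - pi6); split => //.
  + exact: beats_square.
  + exact: Bg.
  + by split => //; rewrite -/E3; ring.
- by case: eg; lra.
Qed.

Lemma triple_square e f g x y z : wuncovered e -> wuncovered f ->
  wuncovered g ->
  `|x - half_angle e - half_angle f| <= 2 * pi6 ->
    `|y - half_angle f - half_angle g| <= 2 * pi6 ->
  `|z - half_angle g - half_angle e| <= 2 * pi6 -> triple e f g x y z.
Proof.
rewrite !ler_norml => E F G /andP[x1 x2] /andP[y1 y2] /andP[z1 z2].
exists ((z - half_angle g - half_angle e) / 2),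
  ((x - half_angle e - half_angle f) / 2),
  ((x - half_angle e - half_angle f) / 2),
    ((y - half_angle f - half_angle g) / 2),
  ((y - half_angle f - half_angle g) / 2),
    ((z - half_angle g - half_angle e) / 2).
by split; [..|split; lra]; apply: beats_square => //; rewrite ler_norml; lra.
Qed.

Definition improvable e f g x y z :=
  (swap e f x \/ cross e f x) \/ (swap f g y \/ cross f g y) \/
  (swap g e z \/ cross g e z) \/ triple e f g x y z.

Lemma improvable_rot e f g x y z : improvable f g e y z x ->
  improvable e f g x y z.
Proof.
case=> [H|[H|[H|H]]]; rewrite /improvable; [by right; left|by right; right;
  left|by left|].
do 3 right.
case: H => a [b [a' [b' [a'' [b'' [h1 h2 h3 [s1 s2 s3]]]]]]].
by exists a'', b'', a, b, a', b'; split => //; split; lra.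
Qed.

(* The only configuration in which neither swaps nor the triple succeed with
   all projection angles at most [pi6]: the wedge [f] is wider than [e] and [g]
   together, and these two are close to each other. *)
Definition tall e f g x y z :=
  [/\ wuncovered e, wuncovered f, wuncovered g,
    half_angle e <= half_angle f /\ half_angle g <= half_angle f &
   [/\ 2 * pi6 < x + (half_angle f - half_angle e),
     2 * pi6 < y + (half_angle f - half_angle g),
       x + y + z = 6 * pi6 & 2 * pi6 + half_angle g + half_angle e < z]].

Lemma tall_bounds e f g x y z : tall e f g x y z ->
  [/\ 0 <= half_angle e, half_angle f < 2 * pi6, 0 <= half_angle g,
    half_angle e <= half_angle f &
   [/\ half_angle g <= half_angle f,
     2 * pi6 < x + (half_angle f - half_angle e),
       2 * pi6 < y + (half_angle f - half_angle g) &
         x + y < 4 * pi6 - half_angle g - half_angle e]].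
Proof. by case=> -[_ _ ? ? _] [_ _ ? ? _] [_ _ ? ? _] [? ?] [? ? ? ?];
  split => //; split => //; lra. Qed.

(* [e] is favourable to a swap with [f] when its longer end is on the side
   of [f] (the plus end), because a short end may be projected on a direction
   far from its own. *)
Lemma tall_badl e f g x y z : tall e f g x y z -> plus_len e <= minus_len e ->
  x <= 2 * pi6 -> x + half_angle f + half_angle e <= 3 * pi6 ->
    improvable e f g x y z.
Proof.
case=> E F _ [ef _] [xs _ _ _] pe x2 t2; left.
by apply: swap_or_cross => //; apply: ltW.
Qed.

Lemma tall_badr e f g x y z : tall e f g x y z -> minus_len g <= plus_len g ->
  y <= 2 * pi6 -> y + half_angle f + half_angle g <= 3 * pi6 ->
    improvable e f g x y z.
Proof.
case=> _ /wuncovered_mirror F /wuncovered_mirror G [_ gf] [_ ys _ _] pg y2 t2.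
have [H|H] := swap_or_cross G F pg gf (ltW ys) y2 t2; right; left.
- by left; apply: swap_mirror.
- by right; apply: cross_mirror.
Qed.

Lemma tall_goodl e f g x y z : tall e f g x y z -> 0 <= x ->
  minus_len e <= plus_len e ->
  x <= half_angle f - half_angle e + pi6 \/
    half_angle e <= pi6 /\ x <= 2 * pi6 -> improvable e f g x y z.
Proof. by case=> E F _ [ef _] _ x0 pe H; left; left; apply: swap_good. Qed.

Lemma tall_goodr e f g x y z : tall e f g x y z -> 0 <= y ->
  plus_len g <= minus_len g ->
  y <= half_angle f - half_angle g + pi6 \/
    half_angle g <= pi6 /\ y <= 2 * pi6 -> improvable e f g x y z.
Proof.
case=> _ /wuncovered_mirror F /wuncovered_mirror G [_ gf] _ y0 pg H.
by right; left; left; apply: swap_mirror; apply: swap_good.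
Qed.

Lemma steep_slope a x : 0 <= x <= acos45 - pi6 -> pi6 <= a ->
  pi6 * x <= (acos45 - pi6) * a :> R.
Proof.
have h0 := pi6_gt0 R; move=> /andP[x0 xv] ha.
apply: (@le_trans _ _ (pi6 * (acos45 - pi6))); first by rewrite ler_pM2l.
by rewrite mulrC ler_wpM2l //; lra.
Qed.

Lemma tall_steepl e f g x y z : tall e f g x y z ->
  half_angle e <= pi6 -> 3 * pi6 < x + half_angle f + half_angle e ->
  x + 2 * pi6 - half_angle e - half_angle f <= acos45 - pi6 ->
    improvable e f g x y z.
Proof.
move=> T e1 t1 xv; have [e0 f2 _ _ [_ xs _ _]] := tall_bounds T.
case: T => E F _ _ _; left; left.
apply: swap_steep => //; first exact: ltW.
by apply: steep_slope; lra.
Qed.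

Lemma tall_steepr e f g x y z : tall e f g x y z ->
  half_angle g <= pi6 -> 3 * pi6 < y + half_angle f + half_angle g ->
  y + 2 * pi6 - half_angle g - half_angle f <= acos45 - pi6 ->
    improvable e f g x y z.
Proof.
move=> T e1 t1 xv; have [_ f2 g0 _ [_ _ ys _]] := tall_bounds T.
case: T => _ /wuncovered_mirror F /wuncovered_mirror G _ _; right; left; left.
apply: swap_mirror; apply: swap_steep => //=; first exact: ltW.
by apply: steep_slope; lra.
Qed.

Lemma tall_both e f g x y z : tall e f g x y z ->
  plus_len e <= minus_len e -> minus_len g <= plus_len g ->
  3 * pi6 < x + half_angle f + half_angle e ->
    3 * pi6 < y + half_angle f + half_angle g ->
  improvable e f g x y z.
Proof.
move=> T pe pg t1 t2; have h0 := pi6_gt0 R.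
have [e0 f2 g0 ef [gf xs ys xy]] := tall_bounds T.
set X := x + 2 * pi6 - half_angle e - half_angle f.
set Y := y + 2 * pi6 - half_angle g - half_angle f.
case: (boolP ((half_angle e <= pi6) && (X <= acos45 - pi6))) => [/andP[e1 x1]|].
  exact: (tall_steepl T).
rewrite negb_and -!ltNge => nx.
case: (boolP ((half_angle g <= pi6) && (Y <= acos45 - pi6))) => [/andP[g1 y1]|].
  exact: (tall_steepr T).
rewrite negb_and -!ltNge => ny.
case: (T) => E F G _ [_ _ sum zt].
have X3 : 0 <= X <= 3 * pi6 by rewrite /X; apply/andP; split; lra.
have Y3 : 0 <= Y <= 3 * pi6 by rewrite /Y; apply/andP; split; lra.
have z4 : 0 <= z - half_angle g - half_angle e <= 4 * pi6 by apply/andP; split;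
  lra.
have z3 : pi6 < half_angle e \/ pi6 < half_angle g ->
  z - half_angle g - half_angle e <= 3 * pi6 by case; lra.
have eg : pi6 < half_angle e -> half_angle g <= pi6 by lra.
have YE : y + 2 * pi6 - half_angle f - half_angle g = Y by rewrite /Y; ring.
do 3 right; apply: triple_tilt => //; rewrite ?YE -/X //.
- by case: (leP (half_angle e) pi6) => e1; [left | right; exact: eg].
- by move=> e1; case/orP: nx; [rewrite ltNge e1 | move/ltW].
- by move=> e1; case/orP: ny; [rewrite ltNge e1 | move/ltW].
- case: (leP (half_angle e) pi6) => e1; last by right; apply: z3; left.
  by case: (leP (half_angle g) pi6) => g1; [left | right; apply: z3; right].
Qed.

(** The cases are which end of [e] and which end of [g] is longer. As [x + y < 4 * pi6 - half_angle
    g - half_angle e], a bound that fails on one side yields those needed on the other, except in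
    the situation of [tall_both]. *)
Lemma improvable_tall_aux e f g x y z : tall e f g x y z -> 0 <= x -> 0 <= y ->
  improvable e f g x y z.
Proof.
move=> T x0 y0; have h0 := pi6_gt0 R.
have [e0 f2 g0 ef [gf xs ys xy]] := tall_bounds T.
have badl := tall_badl T; have badr := tall_badr T.
have goodl := tall_goodl T x0; have goodr := tall_goodr T y0.
case: (leP (minus_len e) (plus_len e)) => [pe|/ltW pe];
  case: (leP (plus_len g) (minus_len g)) => [pg|/ltW pg].
- case: (leP x (2 * pi6)) => x2; last by apply: goodr => //; right; split; lra.
  case: (leP (half_angle e) pi6) => eh; first by apply: goodl => //; right.
  by apply: goodr => //; right; split; lra.
- case: (leP x (half_angle f - half_angle e + pi6)) => x1;
    first by apply: goodl => //; left.
  case: (leP (half_angle e) pi6) => eh; last by apply: badr => //; lra.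
  case: (leP x (2 * pi6)) => x2; first by apply: goodl => //; right.
  by apply: badr => //; lra.
- case: (leP y (half_angle f - half_angle g + pi6)) => y1;
    first by apply: goodr => //; left.
  case: (leP (half_angle g) pi6) => gh; last by apply: badl => //; lra.
  case: (leP y (2 * pi6)) => y2; first by apply: goodr => //; right.
  by apply: badl => //; lra.
- case: (leP (x + half_angle f + half_angle e) (3 * pi6)) => tx.
    case: (leP x (2 * pi6)) => x2; first exact: badl.
    by apply: badr => //; lra.
  case: (leP (y + half_angle f + half_angle g) (3 * pi6)) => ty;
    last exact: (tall_both T).
  by apply: badr => //; lra.
Qed.

Lemma improvable_tall e f g x y z : wuncovered e -> wuncovered f ->
  wuncovered g ->
  0 <= x -> 0 <= y -> x + y + z = 6 * pi6 ->
    2 * pi6 + half_angle g + half_angle e < z ->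
  2 * pi6 < x + `|half_angle f - half_angle e| ->
    2 * pi6 < y + `|half_angle g - half_angle f| ->
  improvable e f g x y z.
Proof.
move=> E F G x0 y0 sum zt xs ys; apply: improvable_tall_aux => //.
have [[_ _ te0 _ _] [_ _ tf0 _ _] [_ _ tg0 _ _]] := And3 E F G.
split => //.
  (* If [f] were narrower than a neighbour, [xs] and [ys] would give [x + y > 4 * pi6 - half_angle e
     - half_angle g], against [zt]. *)
  by move: xs ys; case: ger0P => ef; case: ger0P => gf xs ys; split; lra.
by move: xs ys; case: ger0P => ef; case: ger0P => gf xs ys; split; lra.
Qed.
End Triples.

(** * Any three wedges going around the point *)

Section Improvable.
Variable R : realType.
Implicit Types (x y z eps : R) (e f g : wedge R).

(** [x], [y] and [z] stand for [pi] minus the three gaps between consecutive bisectors; the gaps add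
    up to [2 * pi], whence the sum [6 * pi6]. *)
Lemma improvable_gaps e f g x y z : wuncovered e -> wuncovered f ->
  wuncovered g ->
  0 <= x -> 0 <= y -> 0 <= z -> x + y + z = 6 * pi6 -> improvable e f g x y z.
Proof.
move=> E F G x0 y0 z0 sum.
case: (leP (x + `|half_angle f - half_angle e|) (2 * pi6)) => xs.
  by left; left; exact: swap_square.
case: (leP (y + `|half_angle g - half_angle f|) (2 * pi6)) => ys.
  by right; left; left; exact: swap_square.
case: (leP (z + `|half_angle e - half_angle g|) (2 * pi6)) => zs.
  by right; right; left; left; exact: swap_square.
(* Once the swap of a pair fails in the square, its new edge in the triple can violate the square
   only from above. A rotation then brings that edge to the third place, as in [tall]. *)
have H e' f' u : wuncovered e' -> wuncovered f' ->
  2 * pi6 < u + `|half_angle f' - half_angle e'| ->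
    2 * pi6 < `|u - half_angle e' - half_angle f'| ->
      2 * pi6 + half_angle e' + half_angle f' < u.
  move=> [_ _ _ e2 _] [_ _ _ f2 _].
  by case: (ger0P (half_angle f' - half_angle e')) => ?;
    case: (ger0P (u - _ - _)) => ?; lra.
case: (leP `|x - half_angle e - half_angle f| (2 * pi6)) =>
  [xt|/(H _ _ _ E F xs) xt]; last first.
  by apply: improvable_rot; apply: improvable_tall => //; lra.
case: (leP `|y - half_angle f - half_angle g| (2 * pi6)) =>
  [yt|/(H _ _ _ F G ys) yt]; last first.
  by do 2 apply: improvable_rot; apply: improvable_tall => //; lra.
case: (leP `|z - half_angle g - half_angle e| (2 * pi6)) =>
  [zt|/(H _ _ _ G E zs) zt]; last first.
  by apply: improvable_tall => //; lra.
by do 3 right; exact: triple_square.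
Qed.
End Improvable.

(** * From certificates to lengths *)

Section Geometry.
Variable R : realType.
Implicit Types (a b c r s t x y z : R) (e f g : wedge R) (o u v : R * R).

Definition polar o r a : R * R := (o.1 + r * cos a, o.2 + r * sin a).
Definition plus_end o e c := polar o (plus_len e) (c + half_angle e).
Definition minus_end o e c := polar o (minus_len e) (c - half_angle e).

Lemma distC u v : dist u v = dist v u.
Proof. by rewrite /dist -(sqrrN (u.1 - v.1)) -(sqrrN (u.2 - v.2)) !opprB. Qed.

Lemma proj_le x y a : x * cos a + y * sin a <= Num.sqrt (x ^+ 2 + y ^+ 2).
Proof.
case: (leP (x * cos a + y * sin a) 0) => [xy|/ltW xy].
  exact: le_trans xy (sqrtr_ge0 _).
rewrite -(ger0_norm xy) -sqrtr_sqr ler_wsqrtr //.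
have cs := cos2Dsin2 a; have := sqr_ge0 (x * sin a - y * cos a).
have -> : x ^+ 2 + y ^+ 2 = (x ^+ 2 + y ^+ 2) * (cos a ^+ 2 + sin a ^+ 2).
  by rewrite cs mulr1.
by lra.
Qed.

Lemma dist_polar_ge o r s a b t :
  r * cos (a - t) - s * cos (b - t) <= dist (polar o r a) (polar o s b).
Proof.
apply: le_trans (proj_le _ _ t); rewrite /= !cosB; lra.
Qed.

Lemma dist_wedge o e c :
  dist (plus_end o e c) (minus_end o e c) = Num.sqrt (sqlen (plus_len e)
    (minus_len e) (half_angle e)).
Proof.
rewrite /dist /plus_end /minus_end /sqlen /=; congr Num.sqrt.
have -> : 2 * half_angle e = (c + half_angle e) - (c - half_angle e) by ring.
have s1 := cos2Dsin2 (c + half_angle e);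
  have s2 := cos2Dsin2 (c - half_angle e).
rewrite [cos (c + _ - _)]cosB; set A := cos (c + _) in s1 *;
  set A' := sin (c + _) in s1 *.
set B := cos (c - _) in s2 *; set B' := sin (c - _) in s2 *.
have -> : plus_len e ^+ 2 = plus_len e ^+ 2 * (A ^+ 2 + A' ^+ 2)
  by rewrite s1 mulr1.
have -> : minus_len e ^+ 2 = minus_len e ^+ 2 * (B ^+ 2 + B' ^+ 2)
  by rewrite s2 mulr1.
ring.
Qed.

Lemma cos_sub_pi a : cos (6 * pi6 - a) = - cos a :> R.
Proof. by rewrite -pi_pi6 cosB cospi sinpi; ring. Qed.

Lemma cos_add_pi a : cos (6 * pi6 + a) = - cos a :> R.
Proof. by rewrite -pi_pi6 cosD cospi sinpi; ring. Qed.

Lemma dist_polar_antipodal o r s a b t t' : b - t = 6 * pi6 - t' \/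
  b - t = 6 * pi6 + t' ->
  r * cos (a - t) + s * cos t' <= dist (polar o r a) (polar o s b).
Proof.
move=> H; apply: le_trans (dist_polar_ge o r s a b t).
by case: H => ->; rewrite ?cos_sub_pi ?cos_add_pi mulrN opprK.
Qed.

Lemma link_pp o e f c c' a a' : a' - a = 6 * pi6 - (c' - c) - (half_angle f -
  half_angle e) ->
  plus_len e * cos a + plus_len f * cos a' <= dist (plus_end o e c) (plus_end o
    f c').
Proof.
move=> H; have := @dist_polar_antipodal o (plus_len e) (plus_len f) (c +
  half_angle e)
  (c' + half_angle f) (c + half_angle e + a) a'.
have -> : c + half_angle e - (c + half_angle e + a) = - a by ring.
by rewrite cosN; apply; left; lra.
Qed.

Lemma link_mm o e f c c' b b' : b - b' = 6 * pi6 - (c' - c) + (half_angle f -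
  half_angle e) ->
  minus_len e * cos b + minus_len f * cos b' <= dist (minus_end o e c)
    (minus_end o f c').
Proof.
move=> H; have := @dist_polar_antipodal o (minus_len e) (minus_len f) (c -
  half_angle e)
  (c' - half_angle f) (c - half_angle e - b) b'.
have -> : c - half_angle e - (c - half_angle e - b) = b by ring.
by apply; right; lra.
Qed.

Lemma link_pm o e f c c' a b' : a + b' = - (6 * pi6 - (c' - c) + half_angle e +
  half_angle f) ->
  plus_len e * cos a + minus_len f * cos b' <= dist (plus_end o e c) (minus_end
    o f c').
Proof.
move=> H; have := @dist_polar_antipodal o (plus_len e) (minus_len f) (c +
  half_angle e)
  (c' - half_angle f) (c + half_angle e + a) b'.
have -> : c + half_angle e - (c + half_angle e + a) = - a by ring.
by rewrite cosN; apply; right; lra.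
Qed.

Lemma link_mp o e f c c' b a' : a' + b = 6 * pi6 - (c' - c) - half_angle e -
  half_angle f ->
  minus_len e * cos b + plus_len f * cos a' <= dist (minus_end o e c) (plus_end
    o f c').
Proof.
move=> H; have := @dist_polar_antipodal o (minus_len e) (plus_len f) (c -
  half_angle e)
  (c' + half_angle f) (c - half_angle e - b) a'.
have -> : c - half_angle e - (c - half_angle e - b) = b by ring.
by apply; left; lra.
Qed.

Lemma swap_longer o e f c c' : swap e f (6 * pi6 - (c' - c)) ->
  dist (plus_end o e c) (minus_end o e c) + dist (plus_end o f c') (minus_end o
    f c') <
  dist (plus_end o e c) (plus_end o f c') + dist (minus_end o e c) (minus_end o
    f c').
Proof.
case=> a [b [a' [b' [E F /(link_pp o) h1 /(link_mm o) h2]]]].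
by rewrite !dist_wedge; move: E F h1 h2; rewrite /wbeats /beats; lra.
Qed.

Lemma cross_longer o e f c c' : cross e f (6 * pi6 - (c' - c)) ->
  dist (plus_end o e c) (minus_end o e c) + dist (plus_end o f c') (minus_end o
    f c') <
  dist (plus_end o e c) (minus_end o f c') + dist (minus_end o e c) (plus_end o
    f c').
Proof.
case=> a [b [a' [b' [E F /(link_pm o) h1 /(link_mp o) h2]]]].
by rewrite !dist_wedge; move: E F h1 h2; rewrite /wbeats /beats; lra.
Qed.

Lemma polar_period o r a : polar o r (a + 12 * pi6) = polar o r a.
Proof.
have -> : 12 * pi6 = pi *+ 2 :> R by rewrite pi_pi6 -mulr_natl; ring.
by rewrite /polar cosD2pi sinD2pi.
Qed.

Lemma plus_end_period o e c : plus_end o e (c + 12 * pi6) = plus_end o e c.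
Proof. by rewrite /plus_end addrAC polar_period. Qed.

Lemma minus_end_period o e c : minus_end o e (c + 12 * pi6) = minus_end o e c.
Proof. by rewrite /minus_end addrAC polar_period. Qed.

Lemma triple_longer o e f g c c' c'' :
  triple e f g (6 * pi6 - (c' - c)) (6 * pi6 - (c'' - c')) (6 * pi6 - (c + 12 *
    pi6 - c'')) ->
  dist (plus_end o e c) (minus_end o e c) + dist (plus_end o f c') (minus_end o
    f c') +
    dist (plus_end o g c'') (minus_end o g c'') <
  dist (minus_end o e c) (plus_end o f c') + dist (minus_end o f c') (plus_end o
    g c'') +
    dist (minus_end o g c'') (plus_end o e c).
Proof.
case=> a [b [a' [b' [a'' [b'' [E F G [h1 h2 h3]]]]]]].
rewrite addrC in h1; rewrite addrC in h2; rewrite addrC in h3.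
have {}h1 := link_mp o h1; have {}h2 := link_mp o h2; have {}h3 := link_mp o h3.
rewrite plus_end_period in h3; rewrite !dist_wedge.
by move: E F G h1 h2 h3; rewrite /wbeats /beats; lra.
Qed.
End Geometry.

(** * Exchanges in a locally maximum matching *)

Section Matchings.
Variables (R : realType) (n : nat) (p : 'I_n -> R * R).
Implicit Types (s t : seq ('I_n * 'I_n)) (M : {set 'I_n * 'I_n}) (e f g : 'I_n *
  'I_n).

Definition endpoints s := unzip1 s ++ unzip2 s.

Lemma mem_endpoints s v :
  (v \in endpoints s) = has (fun e => (e.1 == v) || (e.2 == v)) s.
Proof.
rewrite mem_cat; apply/orP/hasP.
  by case=> /mapP[e es ->]; exists e => //; rewrite eqxx ?orbT.
case=> e es /orP[] /eqP <-; [left | right]; exact: map_f.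
Qed.

Lemma uniq_map_inj (T U : eqType) (k : T -> U) (s : seq T) :
  uniq (map k s) -> {in s &, injective k}.
Proof.
elim: s => //= x s IH /andP[xs us] a b; rewrite !inE.
case/orP => [/eqP ->|as_]; case/orP => [/eqP ->|bs] // kab.
- by case/negP: xs; rewrite kab map_f.
- by case/negP: xs; rewrite -kab map_f.
- exact: IH.
Qed.

Lemma shared_endpoint s e f v : uniq (endpoints s) -> e \in s -> f \in s ->
  (e.1 == v) || (e.2 == v) -> (f.1 == v) || (f.2 == v) -> e = f.
Proof.
rewrite cat_uniq => /and3P[u1 /hasPn H u2] es fs.
have N a b : a \in s -> b \in s -> a.1 <> b.2.
  move=> as_ bs ab; have : b.2 \in unzip2 s by exact: map_f.
  by move/H; rewrite -ab => /negP; apply; exact: map_f.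
case/orP => /eqP <- /orP[] /eqP fe.
- exact: (uniq_map_inj u1).
- by case: (N e f).
- by case: (N f e).
- exact: (uniq_map_inj u2).
Qed.

Lemma perfect_matching_seq s (S : {set 'I_n}) : uniq (endpoints s) ->
  S =i endpoints s -> perfect_matching S [set e in s].
Proof.
move=> us Ss; split => [e|v].
  rewrite inE => es; split; rewrite ?Ss ?mem_endpoints; last 2 first.
  - by apply/hasP; exists e; rewrite ?eqxx.
  - by apply/hasP; exists e; rewrite ?eqxx ?orbT.
  move: us; rewrite cat_uniq => /and3P[_ /hasPn /(_ e.2) H _].
  apply/eqP => e12; have /H /negP : e.2 \in unzip2 s by exact: map_f.
  by apply; rewrite -e12; exact: map_f.
rewrite Ss mem_endpoints => /hasP[e es ev].
apply/eqP; rewrite -(cards1 e); apply/eqP; congr #|pred_of_set _|.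
apply/setP => f; rewrite !inE; apply/andP/eqP => [[fs fv]|-> //].
exact: (shared_endpoint us fs es fv ev).
Qed.

Lemma weight_seq s : uniq s ->
  weight p [set e in s] = \sum_(e <- s) dist (p e.1) (p e.2).
Proof. by move=> us; rewrite big_uniq //; apply: eq_bigl => e; rewrite inE. Qed.

Lemma uniq_endpoints M s : perfect_matching [set: 'I_n] M -> uniq s ->
  {subset s <= M} -> uniq (endpoints s).
Proof.
move=> [M1 M2] us sM.
have same e f v : e \in s -> f \in s -> (e.1 == v) || (e.2 == v) ->
    (f.1 == v) || (f.2 == v) -> e = f.
  move=> /sM eM /sM fM ev fv.
  have /eqP /cards1P[g Hg] := M2 v (finset.in_setT v).
  have : e \in [set g]%SET by rewrite -Hg inE eM.
  have : f \in [set g]%SET by rewrite -Hg inE fM.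
  by rewrite !inE => /eqP -> /eqP ->.
rewrite cat_uniq !map_inj_in_uniq ?us ?andbT.
- apply/hasPn => v /mapP[e es ->]; apply/negP => /mapP[f fs ef].
  have fe : f = e by apply: (same f e e.2); rewrite // -?ef eqxx ?orbT.
  by have [/eqP] := M1 e (sM e es); case; rewrite ef fe.
- by move=> e f es fs ef; apply: (same e f f.2); rewrite // -?ef eqxx ?orbT.
- by move=> e f es fs ef; apply: (same e f f.1); rewrite // -?ef eqxx ?orbT.
Qed.

(** Permuting the endpoints keeps them distinct, so [t] is again a perfect matching on the vertices
    of [s]. *)
Lemma local_max_exchange k M s t : perfect_matching [set: 'I_n] M ->
  local_max p k M -> uniq s -> {subset s <= M} -> (size s <= k)%N ->
  perm_eq (endpoints t) (endpoints s) ->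
  \sum_(e <- t) dist (p e.1) (p e.2) <= \sum_(e <- s) dist (p e.1) (p e.2).
Proof.
move=> Mperf Mloc us sM sk ts.
have ues := uniq_endpoints Mperf us sM.
have uet : uniq (endpoints t) by rewrite (perm_uniq ts).
have ut : uniq t by apply: (@map_uniq _ _ fst); move: uet;
  rewrite cat_uniq => /andP[].
rewrite -(weight_seq us) -(weight_seq ut).
have [] := Mloc [set e in s].
- by apply/fintype.subsetP => e; rewrite inE => /sM.
- by rewrite (leq_trans _ sk) // cardsE (card_uniqP us).
move=> _; apply; apply: perfect_matching_seq => // v.
rewrite (perm_mem ts) mem_endpoints inE; apply/existsP/hasP.
  by case=> e /andP[]; rewrite inE; exists e.
by case=> e es ev; exists e; rewrite inE es.
Qed.

Definition ends e a b := e = (a, b) \/ e = (b, a).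

Ltac natb :=
  match goal with |- context [nat_of_bool ?b] => move: (nat_of_bool b) => ? end.

Lemma count_ends (P : pred 'I_n) e a b : ends e a b ->
  (P e.1 + P e.2 = P a + P b)%N.
Proof. by case=> ->; rewrite //= addnC. Qed.

Lemma exchange2 M e f a b a' b' : perfect_matching [set: 'I_n] M ->
  local_max p 3 M -> e \in M -> f \in M -> e != f ->
  ends e a b -> ends f a' b' ->
  dist (p a) (p a') + dist (p b) (p b') <= dist (p a) (p b) + dist (p a') (p
    b').
Proof.
move=> Mperf Mloc eM fM ef He Hf.
have := @local_max_exchange 3 M [:: e; f] [:: (a, a'); (b, b')] Mperf Mloc.
rewrite /= inE ef !big_cons !big_nil !addr0 /=.
have -> : dist (p e.1) (p e.2) = dist (p a) (p b).
  by case: He => -> //=; rewrite distC.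
have -> : dist (p f.1) (p f.2) = dist (p a') (p b').
  by case: Hf => -> //=; rewrite distC.
apply => //.
- by move=> g; rewrite !inE => /orP[] /eqP ->.
- apply/permP => P /=; have c := count_ends P.
  by move: (c _ _ _ He) (c _ _ _ Hf); do !natb; lia.
Qed.

Lemma exchange3 M e f g a b a' b' a'' b'' : perfect_matching [set: 'I_n] M ->
  local_max p 3 M -> e \in M -> f \in M -> g \in M -> uniq [:: e; f; g] ->
  ends e a b -> ends f a' b' -> ends g a'' b'' ->
  dist (p b) (p a') + dist (p b') (p a'') + dist (p b'') (p a) <=
  dist (p a) (p b) + dist (p a') (p b') + dist (p a'') (p b'').
Proof.
move=> Mperf Mloc eM fM gM efg He Hf Hg.
have := @local_max_exchange 3 M [:: e; f; g] [:: (b, a'); (b', a'');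
  (b'', a)] Mperf Mloc efg.
rewrite !big_cons !big_nil !addr0 !addrA /=.
have -> : dist (p e.1) (p e.2) = dist (p a) (p b).
  by case: He => -> //=; rewrite distC.
have -> : dist (p f.1) (p f.2) = dist (p a') (p b').
  by case: Hf => -> //=; rewrite distC.
have -> : dist (p g.1) (p g.2) = dist (p a'') (p b'').
  by case: Hg => -> //=; rewrite distC.
apply => //.
- by move=> i; rewrite !inE => /or3P[] /eqP ->.
- apply/permP => P /=; have c := count_ends P.
  by move: (c _ _ _ He) (c _ _ _ Hf) (c _ _ _ Hg); do !natb; lia.
Qed.

(** Double counting of incident vertices and edges: each vertex lies on exactly one edge. *)
Lemma sum_matching M (F : 'I_n -> R) : perfect_matching [set: 'I_n] M ->
  \sum_(e in M) (F e.1 + F e.2) = \sum_v F v.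
Proof.
move=> [M1 M2].
transitivity (\sum_(e in M) \sum_(v | (e.1 == v) || (e.2 == v)) F v).
  apply: eq_bigr => e /M1[e12 _ _].
  rewrite (bigD1 e.1) ?eqxx //=; congr (_ + _).
  rewrite (big_pred1 e.2) // => v; rewrite /= eq_sym (eq_sym v).
  case: (eqVneq e.2 v) => [<-|_]; first by rewrite orbT e12.
  by rewrite orbF andbN.
rewrite (exchange_big_dep predT) //=; apply: eq_bigr => v _.
rewrite -[RHS]mulr1n -(M2 v (finset.in_setT v)) -sumr_const.
by apply: eq_bigl => e; rewrite inE.
Qed.
End Matchings.

(** * Polar coordinates of an edge *)

Section Polar.
Variable R : realType.
Implicit Types (a b c r s t x y z : R) (e f g : wedge R) (o u v : R * R).

Lemma polar_unit x y : x ^+ 2 + y ^+ 2 = 1 ->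
  exists a, [/\ - (6 * pi6) < a, a <= 6 * pi6, x = cos a & y = sin a].
Proof.
move=> xy; have h0 := pi6_gt0 R.
have x1 : -1 <= (x : R) <= 1 by apply/andP; split; nra.
have ca : cos (acos x) = x by rewrite acosK // in_itv.
have sa := sin_acos x1.
have yy : 1 - x ^+ 2 = y ^+ 2 by rewrite -xy addrAC subrr add0r.
rewrite yy sqrtr_sqr in sa.
have a0 := acos_ge0 x1; have a1 := acos_lepi x1; rewrite pi_pi6 in a1.
have [y0|y0] := leP 0 y.
  by exists (acos x); split => //; [lra | rewrite sa ger0_norm].
exists (- acos x); split; rewrite ?cosN ?sinN ?sa ?ltr0_norm ?opprK //;
  last by lra.
rewrite ltrN2 lt_neqAle a1 andbT; apply/eqP => E.
by move: sa; rewrite E -pi_pi6 sinpi ltr0_norm //; lra.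
Qed.

Lemma polar_around c x y : x ^+ 2 + y ^+ 2 = 1 ->
  exists a, [/\ c - 6 * pi6 < a, a <= c + 6 * pi6, x = cos a & y = sin a].
Proof.
move=> xy; have cs := cos2Dsin2 c.
have [|a [a1 a2 ca sa]] := @polar_unit (x * cos c + y * sin c) (y * cos c - x *
  sin c).
  have -> : (x * cos c + y * sin c) ^+ 2 + (y * cos c - x * sin c) ^+ 2 =
    (x ^+ 2 + y ^+ 2) * (cos c ^+ 2 + sin c ^+ 2) by ring.
  by rewrite xy cs mulr1.
exists (c + a); split; [lra | lra | |].
- rewrite cosD -ca -sa.
  by rewrite -[LHS]mulr1 -cs; ring.
- rewrite sinD -ca -sa.
  by rewrite -[LHS]mulr1 -cs; ring.
Qed.

Lemma polar_point o u c : 0 < dist u o ->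
  exists a, [/\ c - 6 * pi6 < a, a <= c + 6 * pi6 & u = polar o (dist u o) a].
Proof.
move=> d0; set d := dist u o in d0 *.
have dd : d ^+ 2 = (u.1 - o.1) ^+ 2 + (u.2 - o.2) ^+ 2.
  by rewrite sqr_sqrtr // addr_ge0 // sqr_ge0.
have dN : d != 0 by rewrite gt_eqF.
have [|a [a1 a2 ca sa]] := @polar_around c ((u.1 - o.1) / d) ((u.2 - o.2) / d).
  by rewrite !expr_div_n -mulrDl -dd divff // expf_neq0.
exists a; split => //; rewrite /polar -ca -sa ![d * _]mulrC !divfK //.
by case: u {d d0 dd dN ca sa} => u1 u2 /=; congr pair; ring.
Qed.

(* The slope at [o], in direction [a], of [fun o => - (dist u o + dist v o)]. *)
Definition bis o u v a :=
  ((u.1 - o.1) * cos a + (u.2 - o.2) * sin a) / dist u o +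
  ((v.1 - o.1) * cos a + (v.2 - o.2) * sin a) / dist v o.

Lemma bisC o u v a : bis o u v a = bis o v u a.
Proof. exact: addrC. Qed.

(** The law of cosines reads [(p + q) ^+ 2 * sin th ^+ 2 + (p - q) ^+ 2 * cos th ^+ 2]. From
    [th = 2 * pi6] on, the first term alone reaches [3 / 4 * (p + q) ^+ 2]. *)
Lemma uncovered_of_dist o e c : 0 < plus_len e -> 0 < minus_len e ->
  0 <= half_angle e <= 3 * pi6 ->
  dist (plus_end o e c) (minus_end o e c) < sqrt3 / 2 * (plus_len e + minus_len
    e) -> wuncovered e.
Proof.
move=> p0 q0 /andP[t0 t3]; have h0 := pi6_gt0 R; have rr := sqrt3_sq R.
have r0 := sqrt3_gt0 R.
rewrite dist_wedge; set S := sqlen _ _ _ => SL.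
have c2 : cos (2 * half_angle e) = 1 - 2 * sin (half_angle e) ^+ 2.
  have -> : 2 * half_angle e = half_angle e + half_angle e by ring.
  by rewrite cosD -!expr2 (cos2sin2 (half_angle e)); ring.
have SE : S = (plus_len e + minus_len e) ^+ 2 * sin (half_angle e) ^+ 2 +
    (plus_len e - minus_len e) ^+ 2 * (1 - sin (half_angle e) ^+ 2).
  by rewrite /S /sqlen c2; ring.
have c3 : 0 <= 1 - sin (half_angle e) ^+ 2 by rewrite -cos2sin2 sqr_ge0.
have S0 : 0 <= S by rewrite SE addr_ge0 // mulr_ge0 // sqr_ge0.
have SL2 : S < 3 / 4 * (plus_len e + minus_len e) ^+ 2.
  rewrite -(sqr_sqrtr S0).
  have -> : 3 / 4 * (plus_len e + minus_len e) ^+ 2 = (sqrt3 / 2 * (plus_len e +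
    minus_len e)) ^+ 2.
    by rewrite exprMn expr_div_n [sqrt3 ^+ 2]expr2 rr; field.
  by rewrite ltr_pXn2r // nnegrE ?sqrtr_ge0 //; apply: mulr_ge0; lra.
split => //; rewrite ltNge; apply/negP => t2.
have s2 : sqrt3 / 2 <= sin (half_angle e).
  by rewrite -sin_2pi6; apply: sin_le => //; move: h0 t2; clear; lra.
have : 3 / 4 <= sin (half_angle e) ^+ 2 by nra.
move=> s34.
have : (plus_len e + minus_len e) ^+ 2 * (3 / 4) <= (plus_len e + minus_len e)
  ^+ 2 * sin (half_angle e) ^+ 2.
  by apply: ler_wpM2l => //; exact: sqr_ge0.
have : 0 <= (plus_len e - minus_len e) ^+ 2 * (1 - sin (half_angle e) ^+ 2).
  by rewrite mulr_ge0 // sqr_ge0.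
by rewrite SE in SL2; lra.
Qed.

(** Placing the bisector within [pi] of a chosen [c0] lets the directions of several edges be
    compared as real numbers. In the last clause, the unit vectors towards the two ends add up to a
    vector of length [2 * cos (half_angle e)] along the bisector. *)
Lemma wedge_of o u v c0 : 0 < dist u o -> 0 < dist v o ->
  dist u v < sqrt3 / 2 * (dist u o + dist v o) ->
  exists e c, [/\ wuncovered e, c0 - 6 * pi6 < c, c <= c0 + 6 * pi6,
    (u = plus_end o e c /\ v = minus_end o e c) \/
      (v = plus_end o e c /\ u = minus_end o e c) &
    forall a, bis o u v a = 2 * cos (half_angle e) * cos (c - a)].
Proof.
move=> u0 v0 duv; have h0 := pi6_gt0 R.
have [al [_ _ Hu]] := polar_point 0 u0.
have [be [/ltW b1 b2 Hv]] := polar_point al v0.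
wlog ab : u v u0 v0 duv al be Hu Hv b1 b2 / be <= al.
  move=> W; case: (leP be al) => ab; first exact: (W _ _ u0 v0 duv _ _ Hu Hv).
  have dvu : dist v u < sqrt3 / 2 * (dist v o + dist u o)
    by rewrite distC addrC.
  have [|||e [c [E c1 c2 P B]]] := W v u v0 u0 dvu be al Hv Hu.
  - by lra.
  - by lra.
  - exact: ltW.
  exists e, c; split => //; first by case: P; [right | left].
  by move=> a; rewrite bisC.
have [c [c1 c2 cc sc]] := polar_around c0 (cos2Dsin2 ((al + be) / 2)).
set e := Wedge (dist u o) (dist v o) ((al - be) / 2).
have same m : cos (c + m) = cos ((al + be) / 2 + m) /\ sin (c + m) = sin ((al +
  be) / 2 + m).
  by rewrite !cosD !sinD cc sc.
have eu : u = plus_end o e c.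
  rewrite {1}Hu /plus_end /e /polar /= !(same _).1 !(same _).2.
  by have -> : (al + be) / 2 + (al - be) / 2 = al by field.
have ev : v = minus_end o e c.
  rewrite {1}Hv /minus_end /e /polar /= !(same _).1 !(same _).2.
  by have -> : (al + be) / 2 - (al - be) / 2 = be by field.
exists e, c; split => //; [|by left|].
  apply: (@uncovered_of_dist o _ c) => //=; first by apply/andP; split; lra.
  by rewrite -eu -ev.
move=> a; rewrite /bis {1 2}Hu {1 2}Hv /polar /=.
have uN : dist u o != 0 by rewrite gt_eqF.
have vN : dist v o != 0 by rewrite gt_eqF.
have -> : cos (c - a) = cos ((al + be) / 2 - a) by rewrite (same _).1.
have X m d : d != 0 -> ((o.1 + d * cos m - o.1) * cos a + (o.2 + d * sin m -
  o.2) * sin a) / d = cos (m - a).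
  by move=> dN; rewrite cosB; field.
rewrite !X //.
have -> : al - a = ((al + be) / 2 - a) + (al - be) / 2 by field.
have -> : be - a = ((al + be) / 2 - a) - (al - be) / 2 by field.
move: ((al + be) / 2 - a) => m.
by rewrite cosD cosB /=; ring.
Qed.
End Polar.

(** * The optimal point *)

Section Balanced.
Variables (R : realType) (n : nat) (p : 'I_n -> R * R) (M : {set 'I_n * 'I_n}).
Variable o : R * R.
Hypotheses (Mperf : perfect_matching [set: 'I_n] M) (Mloc : local_max p 3 M).
Implicit Types (e f g : 'I_n * 'I_n) (w : wedge R) (c : R).

Definition seen_as e w c := wuncovered w /\
  exists a b, [/\ ends e a b, p a = plus_end o w c & p b = minus_end o w c].

Lemma seen_as_period e w c : seen_as e w c -> seen_as e w (c + 12 * pi6).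
Proof.
case=> W [a [b [E pa pb]]]; split => //.
by exists a, b; rewrite plus_end_period minus_end_period.
Qed.

Lemma not_swap e f w w' c c' : e \in M -> f \in M -> e != f ->
  seen_as e w c -> seen_as f w' c' ->
  ~ (swap w w' (6 * pi6 - (c' - c)) \/ cross w w' (6 * pi6 - (c' - c))).
Proof.
move=> eM fM ef [W [a [b [E pa pb]]]] [W' [a' [b' [F pa' pb']]]].
case=> [/(swap_longer o)|/(cross_longer o)]; rewrite -pa -pb -pa' -pb';
  apply/negP.
  by rewrite -leNgt; exact: (exchange2 Mperf Mloc eM fM ef).
have F' : ends f b' a' by case: F; [right | left].
by rewrite -leNgt (distC (p a') (p b')); exact: (exchange2 Mperf Mloc eM fM ef).
Qed.

Lemma not_triple e f g w w' w'' c c' c'' : e \in M -> f \in M -> g \in M ->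
  uniq [:: e; f; g] -> seen_as e w c -> seen_as f w' c' -> seen_as g w'' c'' ->
  ~ triple w w' w'' (6 * pi6 - (c' - c)) (6 * pi6 - (c'' - c')) (6 * pi6 - (c +
    12 * pi6 - c'')).
Proof.
move=> eM fM gM efg [W [a [b [E pa pb]]]] [W' [a' [b' [F pa' pb']]]].
move=> [W'' [a'' [b'' [G pa'' pb'']]]] /(triple_longer o).
rewrite -pa -pb -pa' -pb' -pa'' -pb''; apply/negP; rewrite -leNgt.
exact: (exchange3 Mperf Mloc eM fM gM efg).
Qed.

Lemma not_improvable e f g w w' w'' c c' c'' : e \in M -> f \in M -> g \in M ->
  uniq [:: e; f; g] -> seen_as e w c -> seen_as f w' c' -> seen_as g w'' c'' ->
  c' - c <= 6 * pi6 -> c'' - c' <= 6 * pi6 ->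
    c + 12 * pi6 - c'' <= 6 * pi6 -> False.
Proof.
move=> eM fM gM efg E F G h1 h2 h3.
have [ef eg fg] : [/\ e != f, g != e & f != g].
  by move: efg; rewrite /= !inE negb_or !andbT (eq_sym g) =>
    /andP[/andP[-> ->] ->].
have := @improvable_gaps R w w' w'' (6 * pi6 - (c' - c)) (6 * pi6 - (c'' - c'))
  (6 * pi6 - (c + 12 * pi6 - c'')) E.1 F.1 G.1.
case; [lra|lra|lra|lra| | ].
  exact: (not_swap eM fM ef E F).
case; first exact: (not_swap fM gM fg F G).
case; last exact: (not_triple eM fM gM efg E F G).
exact: (not_swap gM eM eg G (seen_as_period E)).
Qed.

Variable A : {set 'I_n * 'I_n}.
Hypothesis AM : {subset A <= M}.
Hypothesis pos : forall e, e \in A -> 0 < dist (p e.1) o /\ 0 < dist (p e.2) o.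
Hypothesis thin : forall e, e \in A ->
  dist (p e.1) (p e.2) < sqrt3 / 2 * (dist (p e.1) o + dist (p e.2) o).

(** With all bisectors taken within [pi] of that of [e0], let [f] and [g] be the extreme ones. If
    they span less than [pi], their mean direction works; otherwise [e0], [f], [g] go around [o]. *)
Lemma unbalanced : A != finset.set0 ->
  exists t, forall e, e \in A -> 0 < bis o (p e.1) (p e.2) t.
Proof.
case/finset.set0Pn => e0 e0A; have h0 := pi6_gt0 R.
have rep e c0 : e \in A -> exists w c, [/\ seen_as e w c, c0 - 6 * pi6 < c,
    c <= c0 + 6 * pi6 & forall t,
      bis o (p e.1) (p e.2) t = 2 * cos (half_angle w) * cos (c - t)].
  move=> eA; have [p1 p2] := pos eA.
  have [w [c [W c1 c2 P B]]] := wedge_of c0 p1 p2 (thin eA).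
  exists w, c; split => //; split => //.
  case: P => -[q1 q2]; [exists e.1, e.2 | exists e.2, e.1]; split => //.
    by left; case: (e).
  by right; case: (e).
have [w0 [c0 [S0 _ _ B0]]] := rep e0 0 e0A.
have ex e : exists wc : wedge R * R, e \in A ->
    [/\ seen_as e wc.1 wc.2, c0 - 6 * pi6 < wc.2, wc.2 <= c0 + 6 * pi6,
      forall t, bis o (p e.1) (p e.2) t = 2 * cos (half_angle wc.1) * cos (wc.2
        - t) &
      e = e0 -> wc.2 = c0].
  case: (eqVneq e e0) => [->|ee].
    by exists (w0, c0) => _; split => //=; lra.
  case: (boolP (e \in A)) => eA; last by exists (w0, c0).
  have [w [c [S c1 c2 B]]] := rep e c0 eA.
  by exists (w, c) => _; split => // E; rewrite E eqxx in ee.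
have [k kP] := choice ex.
pose C e := (k e).2.
have C0 : C e0 = c0 by rewrite /C; have [_ _ _ _ ->] := kP e0 e0A.
case: (Order.TotalTheory.arg_maxP C e0A) => f fA fmax.
case: (Order.TotalTheory.arg_minP C e0A) => g gA gmin.
have [S _ _ _ _] := kP e0 e0A; rewrite -/(C e0) C0 in S.
have [Sf _ f2 _ _] := kP f fA; rewrite -/(C f) in Sf f2.
have [Sg g1 _ _ _] := kP g gA; rewrite -/(C g) in Sg g1.
have fc : c0 <= C f by rewrite -C0; exact: fmax.
have gc : C g <= c0 by rewrite -C0; exact: gmin.
have neq e e' : C e != C e' -> e != e' by apply: contraNneq => ->.
case: (ltP (C f - C g) (6 * pi6)) => fg.
  exists ((C f + C g) / 2) => e eA.
  have [[[_ _ t0 t2 _] _] _ _ -> _] := kP e eA.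
  have e1 : C e <= C f := fmax e eA; have e2 : C g <= C e := gmin e eA;
    rewrite -/(C e).
  rewrite !mulr_gt0 //; apply: cos_gt0_pihalf; rewrite pi_pi6; lra.
(* The window is open at [c0 - pi], so of the two extremes only [C f] can be opposite to [c0]. If it
   is not, [C g < c0 < C f] and the three edges are distinct. If it is, [g] may coincide with [e0],
   but swapping [e0] with [f] suffices. *)
exfalso; case: (ltP (C f) (c0 + 6 * pi6)) => fh.
  have e0f : e0 != f by apply: neq; rewrite C0 lt_eqF //; lra.
  have fg' : f != g by apply: neq; rewrite gt_eqF //; lra.
  have e0g : e0 != g by apply: neq; rewrite C0 gt_eqF //; lra.
  apply: (@not_improvable e0 f g _ _ _ c0 (C f) (C g + 12 * pi6)
    (AM e0A) (AM fA) (AM gA) _ S Sf (seen_as_period Sg)); try lra.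
  by rewrite /= !inE negb_or e0f e0g fg'.
have e0f : e0 != f by apply: neq; rewrite C0 lt_eqF //; lra.
apply: (not_swap (AM e0A) (AM fA) e0f S Sf); left.
have -> : 6 * pi6 - (C f - c0) = 0 by lra.
have [[_ _ t0 t2 _] [_ _ u0 u2 _]] := (S.1, Sf.1).
apply: swap_square; [exact: S.1 | exact: Sf.1 | by [] |].
by rewrite add0r ler_norml; lra.
Qed.
End Balanced.

(** * Euclidean distance and minima of Lipschitz functions *)

Section Distance.
Local Open Scope classical_set_scope.
Local Open Scope ring_scope.
Variable R : realType.
Implicit Types (x y : R) (u v w o : R * R).

Lemma dist_ge0 u v : 0 <= dist u v.
Proof. exact: sqrtr_ge0. Qed.

Lemma sq_dist u v : dist u v ^+ 2 = (u.1 - v.1) ^+ 2 + (u.2 - v.2) ^+ 2.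
Proof. by rewrite sqr_sqrtr // addr_ge0 // sqr_ge0. Qed.

Lemma dist_triangle w u v : dist u v <= dist u w + dist w v.
Proof.
have xy0 : 0 <= dist u w + dist w v by rewrite addr_ge0 ?dist_ge0.
rewrite -(ler_pXn2r (ltn0Sn 1)) ?nnegrE ?dist_ge0 // sqrrD !sq_dist.
have cs : (u.1 - w.1) * (w.1 - v.1) + (u.2 - w.2) * (w.2 - v.2) <=
    dist u w * dist w v.
  apply: le_trans (ler_norm _) _.
  rewrite -(ler_pXn2r (ltn0Sn 1)) ?nnegrE ?normr_ge0 ?mulr_ge0 ?dist_ge0 //.
  rewrite real_normK ?num_real // exprMn !sq_dist.
  have := sqr_ge0 ((u.1 - w.1) * (w.2 - v.2) - (u.2 - w.2) * (w.1 - v.1)).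
  lra.
lra.
Qed.

Lemma dist_le_coord u v : dist u v <= `|u.1 - v.1| + `|u.2 - v.2|.
Proof.
rewrite -(ler_pXn2r (ltn0Sn 1)) ?nnegrE ?dist_ge0 ?addr_ge0 //.
rewrite sq_dist [(`|_| + _) ^+ 2]sqrrD !real_normK ?num_real //.
by have := mulr_ge0 (normr_ge0 (u.1 - v.1)) (normr_ge0 (u.2 - v.2)); lra.
Qed.

Lemma coord_le_dist u v : `|u.1 - v.1| <= dist u v /\ `|u.2 - v.2| <= dist u v.
Proof.
by split; rewrite -sqrtr_sqr ler_wsqrtr //; have := sqr_ge0 (u.1 - v.1);
  have := sqr_ge0 (u.2 - v.2); lra.
Qed.

Lemma lipschitz_min (F : R * R -> R) (K L : R) (a : R * R) : 0 < K ->
  (forall u v, F u <= F v + K * dist u v) ->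
  (forall u, L < dist a u -> F a < F u) -> exists c, forall u, F c <= F u.
Proof.
move=> K0 lip far.
(* This square contains the disc of radius [L] around [a]; the absolute value keeps [a] inside when
   [L] is negative. *)
pose A := ([set` `[a.1 - `|L|, a.1 + `|L|]%R] `*` [set` `[a.2 - `|L|,
  a.2 + `|L|]%R])%classic.
have cA : compact A by apply: compact_setX; exact: segment_compact.
have L0 : 0 <= `|L| by [].
have aA : A a by split; rewrite /= in_itv /=; lra.
have cF : continuous F.
  move=> u; apply/cvgrPdist_lt => e e0.
  have d0 : 0 < e / (2 * K) by rewrite divr_gt0 // mulr_gt0.
  have /cvgrPdist_lt /(_ _ d0) n1 : (fun v : R * R => v.1) @ u --> u.1
    by exact: cvg_fst.
  have /cvgrPdist_lt /(_ _ d0) n2 : (fun v : R * R => v.2) @ u --> u.2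
    by exact: cvg_snd.
  near=> v.
  have b1 : `|u.1 - v.1| < e / (2 * K) by near: v.
  have b2 : `|u.2 - v.2| < e / (2 * K) by near: v.
  have d : K * dist u v < e.
    have := dist_le_coord u v; rewrite -(ltr_pM2l K0) in b1.
    rewrite -(ltr_pM2l K0) in b2.
    have e1 : K * (e / (2 * K)) = e / 2 by field; rewrite gt_eqF.
    rewrite e1 in b1 b2; rewrite -(ler_pM2l K0) mulrDr; lra.
  have l1 := lip u v; have := lip v u; rewrite distC ltr_norml; lra.
have [||c Ac cmin] := @compact_EVT_min _ R F A _ cA; first by exists a.
  exact: continuous_subspaceT.
exists c => u; case: (leP (dist a u) L) => ul; last first.
  by apply: le_trans (ltW (far u ul)); apply: cmin; rewrite inE.
apply: cmin; rewrite inE; have [c1 c2] := coord_le_dist a u.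
have := ler_norm L; move: c1 c2; rewrite !ler_norml => c1 c2 LL.
by split; rewrite /= in_itv /=; lra.
Unshelve. all: by end_near.
Qed.
End Distance.

(** * Descent of the largest excess *)

Section CommonPoint.
Variables (R : realType) (n : nat) (p : 'I_n -> R * R).
Implicit Types (e f : 'I_n * 'I_n) (o u v : R * R) (r s t : R).

Definition excess e o :=
  dist (p e.1) o + dist (p e.2) o - 2 / sqrt3 * dist (p e.1) (p e.2).

Lemma excess_lip e u v : excess e u <= excess e v + 2 * dist u v.
Proof.
have := dist_triangle v (p e.1) u; have := dist_triangle v (p e.2) u.
by rewrite /excess (distC v u); lra.
Qed.

Lemma two_sqrt3_gt1 : 1 < 2 / sqrt3 :> R.
Proof.
have r0 := sqrt3_gt0 R; have [_ r2] := sqrt3_bounds R.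
by rewrite ltr_pdivlMr //; lra.
Qed.

Lemma half_sqrt3_inv : sqrt3 / 2 * (2 / sqrt3) = 1 :> R.
Proof. by field; rewrite gt_eqF ?sqrt3_gt0. Qed.

Lemma excess_thin e o : 0 < excess e o ->
  dist (p e.1) (p e.2) < sqrt3 / 2 * (dist (p e.1) o + dist (p e.2) o).
Proof.
have r0 := sqrt3_gt0 R; rewrite /excess subr_gt0 => H.
have rr : 0 < sqrt3 / 2 :> R by lra.
rewrite -(ltr_pM2l rr) in H; apply: le_lt_trans H.
by rewrite mulrA half_sqrt3_inv mul1r.
Qed.

Lemma excess_pos e o : 0 < excess e o ->
  0 < dist (p e.1) o /\ 0 < dist (p e.2) o.
Proof.
have l1 := two_sqrt3_gt1; rewrite /excess => H.
have d0 := dist_ge0 (p e.1) (p e.2).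
have H2 : dist (p e.1) (p e.2) < dist (p e.1) o + dist (p e.2) o.
  have : dist (p e.1) (p e.2) <= 2 / sqrt3 * dist (p e.1) (p e.2).
    by rewrite ler_peMl // ltW.
  by lra.
have := dist_triangle (p e.2) (p e.1) o;
  have := dist_triangle (p e.1) (p e.2) o.
by rewrite (distC (p e.2) (p e.1)); split; lra.
Qed.

(** The square of the second-order expansion on the right exceeds the true squared distance by a
    perfect square, so the bound holds for every [r >= 0], not only asymptotically. *)
Lemma dist_step u o r t : 0 < dist u o -> 0 <= r ->
  dist u (polar o r t) <= dist u o -
    r * (((u.1 - o.1) * cos t + (u.2 - o.2) * sin t) / dist u o) +
    r ^+ 2 / (2 * dist u o).
Proof.
set d := dist u o => d0 r0; set z := _ * cos t + _.
have zd : z <= d by exact: proj_le.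
have dN : d != 0 by rewrite gt_eqF.
have pos : 0 <= d - r * (z / d) + r ^+ 2 / (2 * d).
  have -> : d - r * (z / d) + r ^+ 2 / (2 * d) =
    (2 * (r * (d - z)) + (d - r) ^+ 2 + d ^+ 2) / (2 * d) by field.
  rewrite divr_ge0 ?addr_ge0 ?sqr_ge0 ?mulr_ge0 ?subr_ge0 //; lra.
rewrite -(ler_pXn2r (ltn0Sn 1)) ?nnegrE ?dist_ge0 // sq_dist /=.
have -> : (u.1 - (o.1 + r * cos t)) ^+ 2 + (u.2 - (o.2 + r * sin t)) ^+ 2 =
    d ^+ 2 - 2 * r * z + r ^+ 2.
  have r2 : r ^+ 2 = r ^+ 2 * (cos t ^+ 2 + sin t ^+ 2)
    by rewrite cos2Dsin2 mulr1.
  by rewrite [r ^+ 2 in RHS]r2 /d sq_dist /z; ring.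
have -> : (d - r * (z / d) + r ^+ 2 / (2 * d)) ^+ 2 =
    d ^+ 2 - 2 * r * z + r ^+ 2 + (r * (z / d) - r ^+ 2 / (2 * d)) ^+ 2
      by field.
by rewrite lerDl sqr_ge0.
Qed.

Lemma excess_step e o t : 0 < excess e o -> 0 < bis o (p e.1) (p e.2) t ->
  exists2 d, 0 < d & forall r, 0 < r <= d ->
    excess e (polar o r t) < excess e o.
Proof.
move=> /excess_pos [p0 q0] B; rewrite /excess.
have s1 := fun r => @dist_step (p e.1) o r t p0.
have s2 := fun r => @dist_step (p e.2) o r t q0.
move: B; rewrite /bis; set z1 := _ / dist (p e.1) o in s1 *.
set z2 := _ / dist (p e.2) o in s2 * => B.
set P := dist (p e.1) o in p0 s1 *; set Q := dist (p e.2) o in q0 s2 *.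
set K := 1 / (2 * P) + 1 / (2 * Q).
have K0 : 0 < K by rewrite addr_gt0 // divr_gt0 // mulr_gt0.
(* Up to this [r], the quadratic error [r ^+ 2 * K] uses at most half of the linear gain
   [r * (z1 + z2)]. *)
exists ((z1 + z2) / 2 / K); first by rewrite !divr_gt0.
move=> r /andP[r0]; rewrite ler_pdivlMr // => rK.
have {}s1 := s1 r (ltW r0); have {}s2 := s2 r (ltW r0).
have : r * (r * K) <= r * ((z1 + z2) / 2) by rewrite ler_pM2l.
have -> : r * (r * K) = r ^+ 2 / (2 * P) + r ^+ 2 / (2 * Q).
  by rewrite /K; field; rewrite !gt_eqF.
have : 0 < r * (z1 + z2) by rewrite mulr_gt0.
by lra.
Qed.

Lemma common_step (s : seq ('I_n * 'I_n)) (P : 'I_n * 'I_n -> R -> Prop) :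
  (forall e, e \in s -> exists2 d, 0 < d & forall r, 0 < r <= d -> P e r) ->
  exists2 d, 0 < d & forall e, e \in s -> P e d.
Proof.
move=> H; suff [d d0 dP] : exists2 d, 0 < d & forall e r, e \in s ->
  0 < r <= d -> P e r.
  by exists d => // e es; apply: dP; rewrite // d0 lexx.
elim: s H => [|e s IH] H; first by exists 1.
have [d1 d10 d1P] := H e (mem_head _ _).
have [f fs|d2 d20 d2P] := IH; first by apply: H; rewrite inE fs orbT.
exists (Num.min d1 d2); first by rewrite lt_min d10.
move=> f r; rewrite inE le_min => /orP[/eqP ->|fs] /and3P[r0 r1 r2].
  by apply: d1P; rewrite r0.
by apply: d2P; rewrite ?r0.
Qed.

Lemma common_point (M : {set 'I_n * 'I_n}) :
  perfect_matching [set: 'I_n] M -> local_max p 3 M ->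
  exists o, forall e, e \in M -> excess e o <= 0.
Proof.
move=> Mperf Mloc.
case: (finset.set_0Vmem M) => [->|[e0 e0M]].
  by exists (0, 0) => e; rewrite finset.in_set0.
pose F o := excess [arg max_(e > e0 in M) excess e o]%O o.
have Fmax o e : e \in M -> excess e o <= F o.
  by move=> eM; rewrite /F; case: (Order.TotalTheory.arg_maxP (excess^~ o) e0M)
    => f _; exact.
have Fex o : exists2 e, e \in M & F o = excess e o.
  by rewrite /F; case: (Order.TotalTheory.arg_maxP (excess^~ o) e0M) => f fM _;
    exists f.
(* Beyond this radius around [p e0.1], the excess of [e0] alone is larger than [F (p e0.1)]. *)
have [||o omin] := @lipschitz_min R F 2 (F (p e0.1) + 2 / sqrt3 * dist (p e0.1)
  (p e0.2)) (p e0.1) (ltr0Sn _ 1).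
- move=> u v; have [e eM ->] := Fex u.
  by apply: le_trans (excess_lip e u v) _; rewrite lerD2r; exact: Fmax.
- move=> u far; apply: lt_le_trans (Fmax u e0 e0M); rewrite /excess.
  by have := dist_ge0 (p e0.2) u; lra.
exists o => e eM; apply: le_trans (Fmax o e eM) _; rewrite leNgt;
  apply/negP => t0.
pose A := [set e in M | excess e o == F o]%SET.
have AP f : f \in A -> f \in M /\ 0 < excess f o.
  by rewrite inE => /andP[fM /eqP ->].
have [||||t tP] := @unbalanced R n p M o Mperf Mloc A.
- by move=> f /AP[].
- by move=> f /AP[_ /excess_pos].
- by move=> f /AP[_ /excess_thin].
- have [f fM Ff] := Fex o; apply/finset.set0Pn; exists f.
  by rewrite inE fM Ff eqxx.
have [f fs|d d0 dP] := @common_step (enum M) (fun f r =>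
  excess f (polar o r t) < F o).
  rewrite mem_enum in fs; have [fA|fA] := boolP (f \in A).
    have [_ f0] := AP f fA; have [d d0 dP] := excess_step f0 (tP f fA).
    exists d => // r /dP; move: fA; rewrite inE => /andP[_ /eqP ->]; exact.
  have lt : excess f o < F o.
    rewrite lt_neqAle Fmax // andbT; move: fA; rewrite inE fs /=; exact.
  (* The excess is 2-Lipschitz, so a step of this size uses at most half of the slack of an edge
     that does not attain the maximum. *)
  exists ((F o - excess f o) / 4); first by rewrite divr_gt0 // subr_gt0.
  move=> r /andP[r0 rd].
  have := excess_lip f (polar o r t) o.
  have -> : dist (polar o r t) o = r.
    rewrite /dist /polar /= addrAC subrr add0r [o.2 + _ - _]addrAC subrr add0r.
    by rewrite !exprMn -mulrDr cos2Dsin2 mulr1 sqrtr_sqr gtr0_norm.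
  by lra.
have [f fM Ff] := Fex (polar o d t).
have := omin (polar o d t); rewrite Ff; apply/negP; rewrite -ltNge; apply: dP.
by rewrite mem_enum.
Qed.
End CommonPoint.

Theorem theorem5 (R : realType) (n : nat) (p : 'I_n -> R * R)
  (M Mstar : {set 'I_n * 'I_n}) :
  injective p -> ~~ odd n ->
  perfect_matching [set: 'I_n] M -> local_max p 3 M ->
  max_matching p [set: 'I_n] Mstar ->
  Num.sqrt 3 / 2 * weight p Mstar <= weight p M.
Proof.
move=> _ _ Mperf Mloc [Sperf _]; have [o oP] := common_point Mperf Mloc.
have -> : Num.sqrt 3 = sqrt3 :> R by rewrite sqrt3.unlock.
have r0 := sqrt3_gt0 R.
have up : weight p Mstar <= \sum_v dist (p v) o.
  rewrite -(sum_matching (fun v => dist (p v) o) Sperf); apply: ler_sum => e _.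
  by rewrite (distC (p e.2)); exact: dist_triangle.
have down : \sum_v dist (p v) o <= 2 / sqrt3 * weight p M.
  rewrite -(sum_matching (fun v => dist (p v) o) Mperf) mulr_sumr; apply: ler_sum => e eM.
  by rewrite -subr_le0; exact: oP.
have rr : 0 < sqrt3 / 2 :> R by lra.
have := le_trans up down; rewrite -(ler_pM2l rr) => /le_trans; apply.
by rewrite mulrA half_sqrt3_inv mul1r.
Qed.
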